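(* Let $R=\bigoplus_{\gamma\in\Gamma}R_\gamma$ be a $\Gamma$-graded $K$-algebra, where $\Gamma$ is an ordered semigroup by a total ordering, and suppose that $R$ has a two-sided admissible system $(\mathcal{B},\prec_{gr})$ in which $\mathcal{B}$ is a skew multiplicative $K$-basis of $R$ consisting of $\Gamma$-homogeneous elements and $\prec_{gr}$ is a $\Gamma$-graded two-sided monomial ordering on $\mathcal{B}$. Let $I$ be an ideal of $R$, $A=R/I$. If $I=\langle\mathscr{G}\rangle$ is generated by a Gröbner basis $\mathscr{G}$ such that $\mathbf{LH}(\mathscr{G})$ consists of monomials and $\Gamma$-homogeneous skew 2-nomials, then: (i) $\langle\mathbf{LH}(I)\rangle=\langle\mathbf{LH}(\mathscr{G})\rangle$ is a $\Gamma$-graded skew 2-nomial ideal, the $\Gamma$-leading homogeneous algebra $A^\Gamma_{\rm LH}=R/\langle\mathbf{LH}(I)\rangle$ of $A$ is a skew 2-nomial algebra, and hence $A$ is an almost skew 2-nomial algebra. (ii) Let $N(I)$ be the set of normal monomials in $\mathcal{B}$ (modulo $I$), and $\widehat{N(I)}=\{\hat u=u+\langle\mathbf{LH}(I)\rangle\mid u\in N(I)\}$ the corresponding $K$-basis of $A^\Gamma_{\rm LH}$. Then $\widehat{N(I)}$ is a skew multiplicative $K$-basis of $A^\Gamma_{\rm LH}$. If furthermore there is a (left, right, or two-sided) monomial ordering $\prec_{\mathbf{LH}(I)}$ on $\widehat{N(I)}$, then $A^\Gamma_{\rm LH}$ has a (left, right, or two-sided) Gröbner basis theory with respect to the admissible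 system $(\widehat{N(I)},\prec_{\mathbf{LH}(I)})$. (iii) If $A^\Gamma_{\rm LH}$ is a domain and $\prec_{\widehat{gr}}$ is a $\Gamma$-graded (left, right, or two-sided) monomial ordering on $\widehat{N(I)}$, then $A$ has a (left, right, or two-sided) Gröbner basis theory with respect to the (left, right, or two-sided) admissible system $(\overline{N(I)},\prec)$, where $\overline{N(I)}=\{\bar u=u+I\mid u\in N(I)\}$ is the $K$-basis of $A$ determined by $N(I)$, and the monomial ordering $\prec$ on $\overline{N(I)}$ is defined by the rule: for $\bar u,\bar v\in\overline{N(I)}$, $\bar u\prec\bar v$ whenever $\hat u\prec_{\widehat{gr}}\hat v$.
   Context: $K$ is a field, $K^*=K\setminus\{0\}$; a $K$-algebra is a finitely generated associative $K$-algebra with identity $1$; ''ideal'' without qualification means two-sided ideal; $\langle S\rangle$ is the two-sided ideal generated by $S$. An ordered semigroup is a semigroup with a total ordering $<$ compatible with multiplication ($\gamma_1<\gamma_2$ implies $\gamma\gamma_1<\gamma\gamma_2$ and $\gamma_1\gamma<\gamma_2\gamma$). A skew multiplicative $K$-basis of a $K$-algebra is a $K$-basis $\mathcal{B}$, consisting of products of powers of the generators, such that for all $u,v\in\mathcal{B}$ either $uv=0$ or $uv=\lambda w$ with $\lambda\in K^*$, $w\in\mathcal{B}$. Elements of $\mathcal{B}$ are called monomials; elements $v-\lambda u$ with $v,u\in\mathcal{B}$, $\lambda\in K^*$ are skew 2-nomials. A skew 2-nomial ideal is an ideal generated by monomials and skew 2-nomials, and the quotient of $R$ by such an ideal is a skew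 2-nomial algebra. Let $\mathscr{B}$ be any $K$-basis of a $K$-algebra $\Lambda$ (not necessarily skew multiplicative). Given a well-ordering $\prec$ on $\mathscr{B}$ and $0\ne f=\sum_{i=1}^s\lambda_iu_i$ with $\lambda_i\in K^*$, $u_i\in\mathscr{B}$, $u_1\prec\cdots\prec u_s$, put $\mathbf{LM}(f)=u_s$; $\mathbf{LM}(0)=0$. The well-ordering $\prec$ is a two-sided monomial ordering if: (MO1) whenever $w,u,v,s\in\mathscr{B}$, $w\prec u$ and $\mathbf{LM}(vws),\mathbf{LM}(vus)\notin K^*\cup\{0\}$, then $\mathbf{LM}(vws)\prec\mathbf{LM}(vus)$; (MO2) for $w,u\in\mathscr{B}$, if $u=\mathbf{LM}(vws)$ for some $v,s\in\mathscr{B}$ with $v\ne1$ or $s\ne1$ (in case $1\in\mathscr{B}$), then $w\prec u$. It is a left monomial ordering if: whenever $w,u,v\in\mathscr{B}$, $w\prec u$ and $\mathbf{LM}(vw),\mathbf{LM}(vu)\notin K^*\cup\{0\}$, then $\mathbf{LM}(vw)\prec\mathbf{LM}(vu)$; and for $w,u\in\mathscr{B}$, if $u=\mathbf{LM}(vw)$ for some $v\in\mathscr{B}$ with $v\ne1$ (in case $1\in\mathscr{B}$), then $w\prec u$. Right monomial orderings are defined symmetrically. The pair $(\mathscr{B},\prec)$ is then a (two-sided, left, right) admissible system. If $\Lambda$ is $\Gamma$-graded and $\mathscr{B}$ consists of homogeneous elements of degree $d(\cdot)$, a $\Gamma$-graded (left, right, two-sided) monomial ordering is a (left, right, two-sided)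 monomial ordering $\prec_{gr}$ given, from some well-ordering $\prec$ on $\mathscr{B}$, by $u\prec_{gr}v$ iff $d(u)<d(v)$, or $d(u)=d(v)$ and $u\prec v$. If the basis is skew multiplicative, an algebra has a (left, right, two-sided) Gröbner basis theory if it has a (left, right, two-sided) admissible system with that basis. For a basis $\mathscr{B}$ that is not necessarily skew multiplicative (as for $A$ in (iii)): $u\mid v$ means $v=\mathbf{LM}(wus)$ for some $w,s\in\mathscr{B}$ (left case $v=\mathbf{LM}(wu)$, right case $v=\mathbf{LM}(us)$), and $\Lambda$ has a (left, right, two-sided) Gröbner basis theory with respect to $(\mathscr{B},\prec)$ if $(\mathscr{B},\prec)$ is a (left, right, two-sided) admissible system and every proper (left, right, two-sided) ideal $J$ has a generating set $\mathcal{G}$ such that for each nonzero $f\in J$, $\mathbf{LM}(g)\mid\mathbf{LM}(f)$ for some $g\in\mathcal{G}$. In $R$: $u\mid v$ means $v=\lambda wus$ with $w,s\in\mathcal{B}$, $\lambda\in K^*$; a Gröbner basis of an ideal $I$ is a set $\mathscr{G}\subset I$ of nonzero elements such that each nonzero $f\in I$ satisfies $\mathbf{LM}(g)\mid\mathbf{LM}(f)$ for some $g\in\mathscr{G}$; $N(I)=\{u\in\mathcal{B}\mid\mathbf{LM}(f)\nmid u\text{ for all }0\ne f\in I\}$. For $0\neq f=r_{\gamma_1}+\cdots+r_{\gamma_s}$ with $0\ne r_{\gamma_i}\in R_{\gamma_i}$, $\gamma_1<\cdots<\gamma_s$, put $\mathbf{LH}(f)=r_{\gamma_s}$; $\mathbf{LH}(S)=\{\mathbf{LH}(f)\mid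 f\in S\}$. $A=R/I$ is an almost skew 2-nomial algebra if $\langle\mathbf{LH}(I)\rangle$ is a skew 2-nomial ideal. $A^\Gamma_{\rm LH}$ carries the $\Gamma$-gradation induced from $R$. *)

(* Defs.v *)
From HB Require Import structures.
From mathcomp Require Import all_boot all_order all_algebra.
From mathcomp Require Import ring_quotient generic_quotient.
From mathcomp Require Import boolp classical_sets.

Set Implicit Arguments.
Unset Strict Implicit.
Unset Printing Implicit Defensive.

Import Order.TTheory GRing.Theory.
Local Open Scope classical_set_scope.
Local Open Scope ring_scope.

(* The library's [algType K] excludes the zero ring; since an ideal may be the
   whole algebra, its quotient may be zero, so 1 = 0 has to be allowed here. *)
Record kalgType (K : pzRingType) := KAlgebra {
  kalg_ring : pzRingType;
  kscale : K -> kalg_ring -> kalg_ring;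
  kscaleA : forall a b v, kscale a (kscale b v) = kscale (a * b) v;
  kscale1 : left_id 1 kscale;
  kscaleDr : right_distributive kscale +%R;
  kscaleDl : forall v, {morph kscale^~ v : a b / a + b};
  kscaleAl : forall k x y, kscale k (x * y) = kscale k x * y;
  kscaleAr : forall k x y, kscale k (x * y) = x * kscale k y
}.

Definition kalg_sort (K : pzRingType) (A : kalgType K) : Type := kalg_ring A.
Coercion kalg_sort : kalgType >-> Sortclass.

Section KAlgebraStructures.
Variables (K : pzRingType) (A : kalgType K).

HB.instance Definition _ := GRing.PzRing.copy (kalg_sort A) (kalg_ring A).
HB.instance Definition _ := GRing.Zmodule_isLmodule.Build K (kalg_sort A)
  (@kscaleA K A) (@kscale1 K A) (@kscaleDr K A) (@kscaleDl K A).

Lemma kalg_scalerAl (k : K) (x y : A) : k *: (x * y) = (k *: x) * y.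
Proof. exact: kscaleAl. Qed.

Lemma kalg_scalerAr (k : K) (x y : A) : k *: (x * y) = x * (k *: y).
Proof. exact: kscaleAr. Qed.

End KAlgebraStructures.

Definition kalg_of_algType (K : pzRingType) (A : algType K) : kalgType K :=
  KAlgebra (@scalerA K A) (@scale1r K A) (@scalerDr K A)
    (fun v a b => scalerDl v a b) (@scalerAl K A) (@scalerAr K A).

HB.mixin Record isOrderedSemigroup (d : Order.disp_t) T
    of Semigroup T & Order.Total d T := {
  osemi_ltl : forall g a b : T, (a < b)%O -> (g * a < g * b)%g%O;
  osemi_ltr : forall g a b : T, (a < b)%O -> (a * g < b * g)%g%O
}.
#[short(type="osemigroupType")]
HB.structure Definition OrderedSemigroup (d : Order.disp_t) :=
  {T of Semigroup T & Order.Total d T & isOrderedSemigroup d T}.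

Variant side := LeftSided | RightSided | TwoSided.

Section Ideals.
Variables (K : fieldType) (A : kalgType K).

Definition is_ideal (sd : side) (J : set A) : Prop :=
  [/\ J 0,
      forall x y, J x -> J y -> J (x - y) &
      match sd with
      | LeftSided => forall a x, J x -> J (a * x)
      | RightSided => forall a x, J x -> J (x * a)
      | TwoSided => forall a x, J x -> J (a * x) /\ J (x * a)
      end].

Definition generated (sd : side) (S : set A) : set A :=
  smallest (is_ideal sd) S.

Record ideal := Ideal {
  ideal_set :> set A;
  idealP : is_ideal TwoSided ideal_set
}.

Lemma generated_is_ideal (S : set A) :
  is_ideal TwoSided (generated TwoSided S).
Proof.
split=> [J [[]//]|x y Sx Sy J [idJ SJ]|a x Sx].
  by case: (idJ) => _ + _; apply; [apply: Sx|apply: Sy].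
by split=> J [idJ SJ]; case: (idJ) => _ _ /(_ a x (Sx J (conj idJ SJ)))[].
Qed.

Definition gen_ideal (S : set A) : ideal := Ideal (generated_is_ideal S).

End Ideals.

(* The residue class algebra A / I. *)
Section QuotientAlgebra.
Variables (K : fieldType) (A : kalgType K) (I : ideal A).

Definition ideal_mem : {pred A} := fun x => `[< ideal_set I x >].

Lemma ideal_memP x : reflect (ideal_set I x) (x \in ideal_mem).
Proof. exact: asboolP. Qed.

Lemma ideal_mem_zmod_closed : zmod_closed ideal_mem.
Proof.
have [I0 IB _] := idealP I; split=> [|x y]; first exact/ideal_memP.
by move=> /ideal_memP Ix /ideal_memP Iy; apply/ideal_memP/IB.
Qed.

HB.instance Definition _ := GRing.isZmodClosed.Build A ideal_mem
  ideal_mem_zmod_closed.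

Definition quot_type : Type := Quotient.quot ideal_mem.

HB.instance Definition _ := GRing.Zmodule.on quot_type.

Definition quot_pi (x : A) : quot_type := \pi_(Quotient.quot ideal_mem)%qT x.
Definition quot_rep (q : quot_type) : A :=
  (repr (q : Quotient.quot ideal_mem))%qT.

Lemma quot_repK : cancel quot_rep quot_pi.
Proof. by move=> q; rewrite /quot_pi /quot_rep reprK. Qed.

Lemma quot_pi_eq x y : quot_pi x = quot_pi y <-> ideal_set I (x - y).
Proof.
split=> [/eqP|Ixy]; last first.
  by apply/eqP; rewrite -Quotient.idealrBE; apply/ideal_memP.
by rewrite -Quotient.idealrBE => /ideal_memP.
Qed.

Lemma quot_pi_is_zmod_morphism : zmod_morphism quot_pi.
Proof. by move=> x y; rewrite /quot_pi !piE. Qed.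

HB.instance Definition _ := GRing.isZmodMorphism.Build A quot_type quot_pi
  quot_pi_is_zmod_morphism.

Definition quot_one : quot_type := quot_pi 1.
Definition quot_mul (p q : quot_type) : quot_type :=
  quot_pi (quot_rep p * quot_rep q).
Definition quot_scale (k : K) (p : quot_type) : quot_type :=
  quot_pi (k *: quot_rep p).

Lemma ideal_quot_rep x : ideal_set I (quot_rep (quot_pi x) - x).
Proof. by apply/quot_pi_eq; rewrite quot_repK. Qed.

Lemma quot_pi_mul x y : quot_pi (x * y) = quot_mul (quot_pi x) (quot_pi y).
Proof.
apply/esym/quot_pi_eq; have [_ IB IM] := idealP I.
set x' := quot_rep (quot_pi x); set y' := quot_rep (quot_pi y).
have -> : x' * y' - x * y = (x' - x) * y' - x * (y - y').
  by rewrite mulrBl mulrBr opprB addrA subrK.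
apply: (IB); first exact: (IM _ _ (ideal_quot_rep x)).2.
apply: (IM _ _ _).1; rewrite -opprB -sub0r; apply: (IB); last exact: ideal_quot_rep.
by have [] := idealP I.
Qed.

Lemma quot_pi_scale k x : quot_pi (k *: x) = quot_scale k (quot_pi x).
Proof.
apply/esym/quot_pi_eq; have [_ _ IM] := idealP I.
rewrite -scalerBr -[X in k *: X]mul1r kalg_scalerAl.
exact: (IM _ _ (ideal_quot_rep x)).1.
Qed.

Lemma quot_mulA : associative quot_mul.
Proof.
move=> x y z; rewrite -[x]quot_repK -[y]quot_repK -[z]quot_repK.
by rewrite -!quot_pi_mul mulrA.
Qed.

Lemma quot_mul1l : left_id quot_one quot_mul.
Proof. by move=> x; rewrite -[x]quot_repK -quot_pi_mul mul1r. Qed.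

Lemma quot_mul1r : right_id quot_one quot_mul.
Proof. by move=> x; rewrite -[x]quot_repK -quot_pi_mul mulr1. Qed.

Lemma quot_mulDl : left_distributive quot_mul +%R.
Proof.
move=> x y z; rewrite -[x]quot_repK -[y]quot_repK -[z]quot_repK.
by rewrite -raddfD -!quot_pi_mul mulrDl raddfD.
Qed.

Lemma quot_mulDr : right_distributive quot_mul +%R.
Proof.
move=> x y z; rewrite -[x]quot_repK -[y]quot_repK -[z]quot_repK.
by rewrite -raddfD -!quot_pi_mul mulrDr raddfD.
Qed.

HB.instance Definition _ := GRing.Zmodule_isPzRing.Build quot_type
  quot_mulA quot_mul1l quot_mul1r quot_mulDl quot_mulDr.

Lemma quot_scaleA a b v :
  quot_scale a (quot_scale b v) = quot_scale (a * b) v.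
Proof. by rewrite -[v]quot_repK -!quot_pi_scale scalerA. Qed.

Lemma quot_scale1 : left_id 1 quot_scale.
Proof. by move=> v; rewrite -[v]quot_repK -quot_pi_scale scale1r. Qed.

Lemma quot_scaleDr : right_distributive quot_scale +%R.
Proof.
move=> a x y; rewrite -[x]quot_repK -[y]quot_repK.
by rewrite -raddfD -!quot_pi_scale scalerDr raddfD.
Qed.

Lemma quot_scaleDl v : {morph quot_scale^~ v : a b / a + b}.
Proof.
by move=> a b; rewrite -[v]quot_repK -!quot_pi_scale scalerDl raddfD.
Qed.

Lemma quot_scaleAl (k : K) (x y : quot_type) :
  quot_scale k (x * y) = quot_scale k x * y.
Proof.
rewrite -[x]quot_repK -[y]quot_repK /GRing.mul /=.
by rewrite -!(quot_pi_scale, quot_pi_mul) kalg_scalerAl.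
Qed.

Lemma quot_scaleAr (k : K) (x y : quot_type) :
  quot_scale k (x * y) = x * quot_scale k y.
Proof.
rewrite -[x]quot_repK -[y]quot_repK /GRing.mul /=.
by rewrite -!(quot_pi_scale, quot_pi_mul) kalg_scalerAr.
Qed.

Definition quot : kalgType K :=
  KAlgebra quot_scaleA quot_scale1 quot_scaleDr quot_scaleDl
    quot_scaleAl quot_scaleAr.

Definition proj (x : A) : quot := quot_pi x.

Lemma proj_eq x y : proj x = proj y <-> ideal_set I (x - y).
Proof. exact: quot_pi_eq. Qed.

Lemma proj_surj (q : quot) : exists x, proj x = q.
Proof. by exists (quot_rep q); apply: quot_repK. Qed.

Lemma proj_is_zmod_morphism : zmod_morphism proj.
Proof. exact: quot_pi_is_zmod_morphism. Qed.

HB.instance Definition _ := GRing.isZmodMorphism.Build A quot proj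
  proj_is_zmod_morphism.

Lemma proj_is_monoid_morphism : monoid_morphism proj.
Proof. by split=> // x y; apply: quot_pi_mul. Qed.

HB.instance Definition _ := GRing.isMonoidMorphism.Build A quot proj
  proj_is_monoid_morphism.

Lemma proj_is_scalable : scalable proj.
Proof. exact: quot_pi_scale. Qed.

HB.instance Definition _ := GRing.isScalable.Build K A quot *:%R proj
  proj_is_scalable.

End QuotientAlgebra.

Definition algebra_isomorphic (K : fieldType) (A1 A2 : kalgType K) : Prop :=
  exists f : {rmorphism A1 -> A2}, scalable f /\ bijective f.

Definition is_domain (K : fieldType) (A : kalgType K) : Prop :=
  (1 : A) <> 0 /\ forall x y : A, x * y = 0 -> x = 0 \/ y = 0.

Section Bases.
Variables (K : fieldType) (A : kalgType K).

Definition lin_span (S : set A) : set A :=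
  [set x | exists s : seq (K * A),
     (forall p, p \in s -> S p.2) /\ x = \sum_(p <- s) p.1 *: p.2].

Definition lin_indep (S : set A) : Prop :=
  forall (s : seq A) (c : A -> K), uniq s -> (forall u, u \in s -> S u) ->
  \sum_(u <- s) c u *: u = 0 -> forall u, u \in s -> c u = 0.

Definition is_basis (B : set A) : Prop := lin_indep B /\ lin_span B = setT.

(* A list of pairs (a, n) stands for the product of the powers a ^+ n, in that
   order; generators may be repeated, as A need not be commutative. *)
Definition products_of_powers (gens : seq A) : set A :=
  [set x | exists w : seq (A * nat),
     (forall p, p \in w -> p.1 \in gens) /\ x = \prod_(p <- w) p.1 ^+ p.2].

Definition generates_algebra (gens : seq A) : Prop :=
  lin_span (products_of_powers gens) = setT.

Definition skew_multiplicative_basis (gens : seq A) (B : set A) : Prop :=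
  [/\ is_basis B,
      B `<=` products_of_powers gens &
      forall u v, B u -> B v ->
        u * v = 0 \/
        exists (l : K) (w : A), [/\ l != 0, B w & u * v = l *: w]].

Definition skew_2nomial (B : set A) (h : A) : Prop :=
  exists (u v : A) (l : K), [/\ B u, B v, l != 0 & h = v - l *: u].

Definition skew_2nomial_ideal (B : set A) (J : set A) : Prop :=
  exists S : set A,
    (forall h, S h -> B h \/ skew_2nomial B h) /\ J = generated TwoSided S.

Definition skew_2nomial_algebra (B : set A) (Q : kalgType K) : Prop :=
  exists J : ideal A,
    skew_2nomial_ideal B J /\ algebra_isomorphic (quot J) Q.

End Bases.

(* The strict relation [lt] lives on the whole algebra, but only its
   restriction to the basis B matters. *)
Section MonomialOrderings.
Variables (K : fieldType) (A : kalgType K).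
Variables (B : set A) (lt : A -> A -> Prop).

Definition well_ordering : Prop :=
  [/\ forall u, B u -> ~ lt u u,
      forall u v w, B u -> B v -> B w -> lt u v -> lt v w -> lt u w,
      forall u v, B u -> B v -> [\/ lt u v, u = v | lt v u] &
      forall S : set A, S `<=` B -> S !=set0 ->
        exists2 m, S m & forall u, S u -> u = m \/ lt m u].

Definition is_LM (f m : A) : Prop :=
  exists (n : nat) (l : 'I_n.+1 -> K) (u : 'I_n.+1 -> A),
    [/\ forall i, l i != 0 /\ B (u i),
        forall i j : 'I_n.+1, (i < j)%N -> lt (u i) (u j),
        f = \sum_i l i *: u i &
        m = u ord_max].

(* The default value of [xget] gives LM 0 = 0. *)
Definition LM (f : A) : A := xget 0 [set m | is_LM f m].

(* x lies in the union of K^* and {0}. *)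
Definition in_scalars (x : A) : Prop := exists k : K, x = k *: (1 : A).

Definition compatible (sd : side) : Prop :=
  match sd with
  | TwoSided => forall w u v s, B w -> B u -> B v -> B s -> lt w u ->
      ~ in_scalars (LM (v * w * s)) -> ~ in_scalars (LM (v * u * s)) ->
      lt (LM (v * w * s)) (LM (v * u * s))
  | LeftSided => forall w u v, B w -> B u -> B v -> lt w u ->
      ~ in_scalars (LM (v * w)) -> ~ in_scalars (LM (v * u)) ->
      lt (LM (v * w)) (LM (v * u))
  | RightSided => forall w u s, B w -> B u -> B s -> lt w u ->
      ~ in_scalars (LM (w * s)) -> ~ in_scalars (LM (u * s)) ->
      lt (LM (w * s)) (LM (u * s))
  end.

Definition increasing (sd : side) : Prop :=
  match sd with
  | TwoSided => forall w u v s, B w -> B u -> B v -> B s ->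
      v <> 1 \/ s <> 1 -> u = LM (v * w * s) -> lt w u
  | LeftSided => forall w u v, B w -> B u -> B v ->
      v <> 1 -> u = LM (v * w) -> lt w u
  | RightSided => forall w u s, B w -> B u -> B s ->
      s <> 1 -> u = LM (w * s) -> lt w u
  end.

Definition monomial_ordering (sd : side) : Prop :=
  [/\ well_ordering, compatible sd & increasing sd].

Definition admissible_system (sd : side) : Prop :=
  is_basis B /\ monomial_ordering sd.

Definition divides (sd : side) (u v : A) : Prop :=
  match sd with
  | TwoSided => exists w s, [/\ B w, B s & v = LM (w * u * s)]
  | LeftSided => exists w, B w /\ v = LM (w * u)
  | RightSided => exists s, B s /\ v = LM (u * s)
  end.

Definition has_groebner_theory (sd : side) : Prop :=
  admissible_system sd /\
  forall J : set A, is_ideal sd J -> J <> setT ->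
    exists2 G : set A, generated sd G = J &
      forall f, J f -> f <> 0 ->
        exists2 g, G g & divides sd (LM g) (LM f).

Definition has_skew_groebner_theory (gens : seq A) (sd : side) : Prop :=
  skew_multiplicative_basis gens B /\ admissible_system sd.

(* Divisibility of monomials, Groebner bases and normal monomials with respect
   to a skew multiplicative basis B. *)
Definition mdivides (u v : A) : Prop :=
  exists (l : K) (w s : A), [/\ l != 0, B w, B s & v = l *: (w * u * s)].

Definition groebner_basis (I G : set A) : Prop :=
  [/\ G `<=` I, forall g, G g -> g <> 0 &
      forall f, I f -> f <> 0 -> exists2 g, G g & mdivides (LM g) (LM f)].

Definition normal_monomials (I : set A) : set A :=
  [set u | B u /\ forall f, I f -> f <> 0 -> ~ mdivides (LM f) u].

End MonomialOrderings.

Section Gradings.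
Variables (K : fieldType) (d : Order.disp_t) (Gamma : osemigroupType d).
Variables (A : kalgType K) (gr : Gamma -> set A).

Definition homogeneous (x : A) : Prop := exists g, gr g x.

Definition gradation : Prop :=
  [/\ forall g, gr g 0 /\
        forall (k : K) x y, gr g x -> gr g y -> gr g (k *: x + y),
      forall g h x y, gr g x -> gr h y -> gr (g * h)%g (x * y),
      forall x, exists (s : seq Gamma) (r : Gamma -> A),
        [/\ uniq s, forall g, g \in s -> gr g (r g) &
            x = \sum_(g <- s) r g] &
      forall (s : seq Gamma) (r : Gamma -> A), uniq s ->
        (forall g, g \in s -> gr g (r g)) ->
        \sum_(g <- s) r g = 0 -> forall g, g \in s -> r g = 0].

Definition graded_ideal (J : set A) : Prop :=
  is_ideal TwoSided J /\
  forall (s : seq Gamma) (r : Gamma -> A), uniq s ->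
    (forall g, g \in s -> gr g (r g)) ->
    J (\sum_(g <- s) r g) -> forall g, g \in s -> J (r g).

Definition is_LH (f h : A) : Prop :=
  exists (n : nat) (g : 'I_n.+1 -> Gamma) (r : 'I_n.+1 -> A),
    [/\ forall i, gr (g i) (r i) /\ r i <> 0,
        forall i j : 'I_n.+1, (i < j)%N -> (g i < g j)%O,
        f = \sum_i r i &
        h = r ord_max].

(* The default value of [xget] gives LH 0 = 0. *)
Definition LH (f : A) : A := xget 0 [set h | is_LH f h].

Definition LH_ideal (I : set A) : ideal A := gen_ideal (LH @` I).

Definition almost_skew_2nomial (B I : set A) : Prop :=
  skew_2nomial_ideal B (LH_ideal I).

(* The degree d(u) of a nonzero homogeneous u is the only g with gr g u. *)
Definition graded_lt (lt : A -> A -> Prop) (u v : A) : Prop :=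
  exists g h, [/\ gr g u, gr h v & (g < h)%O \/ g = h /\ lt u v].

Definition graded_monomial_ordering (sd : side) (B : set A)
    (ltgr : A -> A -> Prop) : Prop :=
  [/\ B `<=` homogeneous,
      monomial_ordering B ltgr sd &
      exists2 lt, well_ordering B lt &
        forall u v, B u -> B v -> ltgr u v <-> graded_lt lt u v].

Definition quot_gr (J : ideal A) (g : Gamma) : set (quot J) :=
  proj J @` gr g.

End Gradings.

Arguments quot_gr {K d Gamma A} gr J g.

(* The relation on residue classes modulo I transported from residue classes
   modulo J through common representatives in N. *)
Definition transported_lt (K : fieldType) (A : kalgType K) (I J : ideal A)
    (N : set A) (lt : quot J -> quot J -> Prop) (x y : quot I) : Prop :=
  exists u v, [/\ N u, N v, x = proj I u, y = proj I v &
                  lt (proj J u) (proj J v)].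

Arguments transported_lt {K A} I {J} N lt x y.

(* Main.v *)
(* Let J = <LH(I)>.  An element x lies in J if and only if each of its
   homogeneous components is 0 or the leading homogeneous part of an element of
   I of the same degree.  Hence J is graded, I and J have the same leading
   monomials and the same normal monomials N, and N maps to a basis of both R/I
   and R/J.  Dividing by G, whose leading homogeneous parts are monomials or
   2-nomials, takes a monomial w modulo J to 0 or to a multiple of one smaller
   monomial, so by well-founded induction to 0 or to a multiple of a normal
   monomial n: this is skew multiplicativity.  If moreover R/J is a domain and w
   is a product of normal monomials, then n is not 0 and w = c n + (terms of
   smaller degree) modulo I, so products of basis elements have the same leading
   monomials in R/I and in R/J, and a graded monomial ordering can be
   transported.  An ideal is a Groebner basis of itself because 1 is a basis
   element and so divisibility of leading monomials is reflexive. *)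

Require Import Defs.
From HB Require Import structures.
From mathcomp Require Import all_boot all_order all_algebra.
From mathcomp Require Import boolp classical_sets.

Set Implicit Arguments.
Unset Strict Implicit.
Unset Printing Implicit Defensive.

Import Order.TTheory GRing.Theory.
Local Open Scope classical_set_scope.
Local Open Scope ring_scope.

(** * Linear spans and linear independence *)

Section LinearSpan.
Variables (K : fieldType) (A : kalgType K).
Implicit Types (S P : set A) (x y : A).

Lemma lin_span_mem S x : S x -> lin_span S x.
Proof.
move=> Sx; exists [:: (1, x)]; rewrite big_seq1 scale1r; split=> // p.
by rewrite inE => /eqP ->.
Qed.

Lemma lin_span0 S : lin_span S 0.
Proof. by exists [::]; rewrite big_nil. Qed.

Lemma lin_spanD S x y : lin_span S x -> lin_span S y -> lin_span S (x + y).
Proof.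
move=> [s [sS ->]] [t [tS ->]]; exists (s ++ t); rewrite big_cat; split=> // p.
by rewrite mem_cat => /orP[/sS|/tS].
Qed.

Lemma lin_spanZ S k x : lin_span S x -> lin_span S (k *: x).
Proof.
move=> [s [sS ->]]; exists [seq (k * p.1, p.2) | p <- s]; split.
  by move=> _ /mapP[p /sS Sp ->].
by rewrite big_map scaler_sumr; apply: eq_bigr => p _; rewrite scalerA.
Qed.

Lemma lin_spanB S x y : lin_span S x -> lin_span S y -> lin_span S (x - y).
Proof. by move=> Sx Sy; rewrite -scaleN1r; apply/lin_spanD/lin_spanZ. Qed.

Lemma lin_span_sub S P : P 0 -> (forall x y, P x -> P y -> P (x + y)) ->
  (forall k x, P x -> P (k *: x)) -> S `<=` P -> lin_span S `<=` P.
Proof.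
move=> P0 PD PZ SP _ [s [sS ->]]; rewrite big_seq.
by apply: (big_ind P) => // p /sS/SP; apply: PZ.
Qed.

Lemma lin_span_trans S P : S `<=` lin_span P -> lin_span S `<=` lin_span P.
Proof.
apply: lin_span_sub; [exact: lin_span0|exact: lin_spanD|exact: lin_spanZ].
Qed.

Lemma lin_spanS S P : S `<=` P -> lin_span S `<=` lin_span P.
Proof. by move=> SP; apply: lin_span_trans => x /SP; apply: lin_span_mem. Qed.

(** Lists in [lin_span] may repeat vectors, while [lin_indep] speaks of duplicate-free ones; a
    repeated vector is absorbed by adding its coefficient to the one already there. *)
Lemma lin_span_uniq S x : lin_span S x ->
  exists (s : seq A) (c : A -> K),
    [/\ uniq s, forall u, u \in s -> S u & x = \sum_(u <- s) c u *: u].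
Proof.
move=> [s [sS ->{x}]]; elim: s sS => [|[k a] s IHs] sS.
  by exists [::], (fun=> 0); rewrite !big_nil.
rewrite big_cons /=.
have [p sp|t [c [t_uniq tS ->]]] := IHs; first by apply: sS;
  rewrite inE sp orbT.
have Sa : S a by apply: (sS (k, a)); rewrite inE eqxx.
have [ta|t'a] := boolP (a \in t).
  exists t, (fun u => (if u == a then k else 0) + c u); split=> //.
  rewrite [RHS](eq_bigr (fun u => (if u == a then k else 0) *: u + c u *: u)).
    rewrite big_split /=; congr (_ + _).
    rewrite (bigD1_seq a) //= eqxx big1 ?addr0 // => u /negPf->.
    by rewrite scale0r.
  by move=> u _; rewrite scalerDl.
exists (a :: t), (fun u => if u == a then k else c u); split.
- by rewrite /= t'a.
- by move=> u; rewrite inE => /predU1P[->|/tS].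
- rewrite big_cons eqxx; congr (_ + _); apply: eq_big_seq => u tu.
  by case: eqP tu t'a => // -> ->.
Qed.

(** If [u] were outside the list expressing it, moving everything to one side would give a relation
    with coefficient 1 at [u]. Uniqueness of leading monomials rests on this. *)
Lemma lin_indep_sub (B : set A) S u :
  lin_indep B -> S `<=` B -> B u -> lin_span S u -> S u.
Proof.
move=> indB SB Bu /lin_span_uniq[s [c [s_uniq sS def_u]]].
have [/sS//|s'u] := boolP (u \in s).
have: 1 = 0 :> K; last by move/eqP; rewrite oner_eq0.
have := indB (u :: s) (fun v => if v == u then 1 else - c v).
rewrite /= s'u s_uniq big_cons eqxx scale1r => /(_ isT) H.
have := H _ _ u; rewrite eqxx; apply; last by rewrite inE eqxx.
  by move=> v; rewrite inE => /predU1P[->|/sS/SB].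
apply/eqP; rewrite addr_eq0 {1}def_u; apply/eqP; rewrite -sumrN.
apply: eq_big_seq => v sv; rewrite -scaleNr; case: eqP => [vu|_].
  by rewrite -vu sv in s'u.
by rewrite opprK.
Qed.

Lemma lin_indep_neq0 (B : set A) u : lin_indep B -> B u -> u <> 0.
Proof.
move=> indB Bu u0.
by have := lin_indep_sub indB (@sub0set _ B) Bu; rewrite u0; apply;
  apply: lin_span0.
Qed.

Lemma lin_indepS (B S : set A) : S `<=` B -> lin_indep B -> lin_indep S.
Proof. by move=> SB indB s c s_uniq sS; apply: indB => // u /sS/SB. Qed.

Lemma lin_indep_eq_scale (B : set A) (u v : A) k :
  lin_indep B -> B u -> B v -> u = k *: v -> u = v.
Proof.
move=> indB Bu Bv uv.
apply: (@lin_indep_sub B [set v]) => //; first by move=> _ ->.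
by rewrite uv; apply/lin_spanZ/lin_span_mem.
Qed.

End LinearSpan.

(** * Leading monomials with respect to a well-ordered basis *)

Section LeadingMonomials.
Variables (K : fieldType) (A : kalgType K) (B : set A) (lt : A -> A -> Prop).
Hypotheses (basisB : is_basis B) (wo : well_ordering B lt).

Let lower m : set A := [set u | B u /\ lt u m].

(* Equivalent to [is_LM B lt f m], but it needs no sorted list of monomials. *)
Definition lead (f m : A) : Prop :=
  B m /\ exists2 c, c != 0 & lin_span (lower m) (f - c *: m).

Let indB : lin_indep B := basisB.1.

Lemma basis_span x : lin_span B x. Proof. by rewrite basisB.2. Qed.

Lemma well_ordering_ind (P : A -> Prop) :
    (forall m, B m -> (forall n, B n -> lt n m -> P n) -> P m) ->
  forall m, B m -> P m.
Proof.
have [lt_irr lt_trans lt_total lt_min] := wo.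
move=> IH m Bm; apply: contrapT => nPm.
have [||k [Bk nPk] k_min] := lt_min [set u | B u /\ ~ P u].
- by move=> u [].
- by exists m.
apply/nPk/IH => // n Bn lt_nk; apply: contrapT => nPn.
have [nk|lt_kn] := k_min n (conj Bn nPn).
  by apply: (lt_irr k) => //; rewrite {1}nk in lt_nk *.
exact/(lt_irr k)/(lt_trans k n k).
Qed.

Lemma lead_scale (c : K) m : B m -> c != 0 -> lead (c *: m) m.
Proof. by move=> Bm c0; split=> //; exists c => //; rewrite subrr;
  apply: lin_span0. Qed.

Lemma lead_self m : B m -> lead m m.
Proof. by move=> Bm; rewrite -{1}[m]scale1r; apply: lead_scale => //;
  apply: oner_neq0. Qed.

(** For [f = 0] the monomial [m] would lie in the span of the monomials below it, hence be one of
    them. *)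
Lemma lead_neq0 f m : lead f m -> f <> 0.
Proof.
move=> [Bm [c c0 lowf]] f0.
have [lt_irr _ _ _] := wo; apply: (lt_irr m) => //.
suff [] : lower m m by [].
apply: (lin_indep_sub indB) => //; first by move=> ? [].
rewrite -[X in lin_span _ X]scale1r -(mulVf c0) -scalerA; apply: lin_spanZ.
by rewrite -[_ *: m]opprK -scaleN1r; apply: lin_spanZ; rewrite -sub0r -f0.
Qed.

Lemma lower_trans m n : B m -> B n -> lt n m -> lower n `<=` lower m.
Proof.
by have [_ lt_trans _ _] := wo; move=> Bm Bn nm u [Bu un]; split=> //;
  apply: lt_trans nm.
Qed.

Lemma lead_low f m n : B n -> lt m n -> lead f m -> lin_span (lower n) f.
Proof.
move=> Bn mn [Bm [c c0 lowf]]; rewrite -(subrK (c *: m) f).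
apply: lin_spanD; last exact/lin_spanZ/lin_span_mem.
by apply: lin_spanS lowf; apply: lower_trans.
Qed.

Lemma leadD_low f h m : lead f m -> lin_span (lower m) h -> lead (f + h) m.
Proof.
move=> [Bm [c c0 lowf]] lowh; split=> //; exists c => //.
by rewrite addrAC; apply: lin_spanD.
Qed.

(** Two leading monomials with [m] below [n] would put [f], and with it [n], in the span of the
    monomials below [n]. *)
Lemma lead_unique f m n : lead f m -> lead f n -> m = n.
Proof.
have [_ _ lt_total _] := wo.
wlog mn : m n / lt m n => [IH fm fn|fm fn].
  have [mn|//|nm] := lt_total m n fm.1 fn.1; first exact: IH.
  by apply/esym/IH.
have [lt_irr _ _ _] := wo.
have [Bn [c c0 lowf]] := fn; case: (lt_irr n) => //.
suff [] : lower n n by [].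
apply: (lin_indep_sub indB) => //; first by move=> ? [].
rewrite -[X in lin_span _ X]scale1r -(mulVf c0) -scalerA.
apply: lin_spanZ; rewrite -[c *: n](subKr f).
by apply: lin_spanB => //; apply: lead_low fm.
Qed.

(** Stated for a downward closed [S] so that it serves both [S = lower m], inside a well-founded
    induction, and [S = B]. Terms are added one at a time; cancellation occurs only when the new one
    ties with the current leading monomial, and the assumption on [lower m] settles what is left. *)
Lemma lead_total_span (S : set A) x : S `<=` B ->
    (forall m, S m -> forall y, lin_span (lower m) y ->
       y = 0 \/ exists2 n, lower m n & lead y n) ->
    (forall m n, S m -> lower m n -> S n) ->
  lin_span S x -> x = 0 \/ exists2 m, S m & lead x m.
Proof.
have [_ _ lt_total _] := wo.
move=> SB lowS closS [s [sS ->{x}]]; elim: s sS => [|[k a] s IHs] sS.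
  by left; rewrite big_nil.
have Sa : S a by apply: (sS (k, a)); rewrite inE eqxx.
rewrite big_cons /=; set x := \sum_(_ <- _) _ in IHs *.
have [->|k0] := eqVneq k 0; first by rewrite scale0r add0r; apply: IHs => p sp;
  apply: sS; rewrite inE sp orbT.
have /IHs[->|[m Sm xm]] : forall p, p \in s -> S p.2.
- by move=> p sp; apply: sS; rewrite inE sp orbT.
- by right; exists a => //; rewrite addr0; apply/lead_scale => //; apply: SB.
have [ma|ma|am] := lt_total m a (SB _ Sm) (SB _ Sa).
- right; exists a => //; apply: leadD_low; first exact/lead_scale/k0/SB.
  by apply: lead_low xm => //; apply: SB.
- have [Bm [c c0 lowx]] := xm.
  have -> : k *: a + x = (k + c) *: m + (x - c *: m).
    by rewrite ma scalerDl -addrA [c *: a + _]addrC subrK.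
  have [->|kc] := eqVneq (k + c) 0.
    rewrite scale0r add0r; have [->|[n mn yn]] := lowS _ Sm _ lowx;
      first by left.
    by right; exists n => //; apply: closS mn.
  by right; exists m => //; apply: leadD_low => //; apply: lead_scale.
- right; exists m => //; rewrite addrC; apply: leadD_low => //.
  by apply/lin_spanZ/lin_span_mem; split=> //; apply: SB.
Qed.

Lemma lead_lower m x : B m -> lin_span (lower m) x ->
  x = 0 \/ exists2 n, lower m n & lead x n.
Proof.
move=> Bm; move: m Bm x; apply: well_ordering_ind => m Bm IH x.
apply: lead_total_span => [u []//|n [Bn nm] y|n p [Bn nm] [Bp pn]];
  first exact: IH.
by split=> //; have [_ lt_trans _ _] := wo; apply: lt_trans pn nm.
Qed.

Lemma lead_exists x : x <> 0 -> exists m, lead x m.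
Proof.
move=> x0; case: (@lead_total_span B x) => // [m Bm y|m n _ [] //||[m _ xm]].
- exact: lead_lower.
- exact: basis_span.
- by exists m.
Qed.

(** Removing the leading term leaves 0 or an element with a smaller leading monomial, whose
    increasing expansion is prolonged by [m]. *)
Lemma lead_is_LM f m : lead f m -> is_LM B lt f m.
Proof.
move=> fm; have Bm := fm.1; move: m Bm f fm;
  apply: well_ordering_ind => m Bm IH f.
move=> [_ [c c0 lowf]]; have [f0|[n [Bn nm] fn]] := lead_lower Bm lowf.
  exists 0%N, (fun=> c), (fun=> m); split=> // [i j|].
    by rewrite !ord1.
  by rewrite big_ord1; apply/eqP; rewrite -subr_eq0 f0.
have [k [l [u [lB u_lt def_f def_n]]]] := IH n Bn nm _ fn.
(* [ext T t x] appends [x] to the family [t] as its last entry; [ord_max] is the one index not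
   lifted from ['I_k.+1]. *)
pose ext T (t : 'I_k.+1 -> T) x (i : 'I_k.+2) :=
  if unlift ord_max i is Some j then t j else x.
have ext_max T (t : _ ->
  T) x : ext T t x ord_max = x by rewrite /ext unlift_none.
have ext_widen T (t : _ -> T) x i : ext T t x (widen_ord (leqnSn _) i) = t i.
  rewrite /ext; have -> : widen_ord (leqnSn _) i = lift ord_max i.
    by apply: ord_inj; rewrite lift_max.
  by rewrite liftK.
exists k.+1, (ext K l c), (ext A u m); split.
- by move=> i; rewrite /ext; case: unliftP.
- move=> i j; case: (unliftP ord_max i) => [i' ->|->]; last first.
    by move=> /= kj; have := leq_trans kj (leq_ord j); rewrite ltnn.
  case: (unliftP ord_max j) => [j' ->|->].
    rewrite !lift_max => ij; rewrite /ext !liftK; exact: u_lt.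
  rewrite /ext liftK unlift_none => _.
  have [_ lt_trans _ _] := wo.
  have Bu := (lB i').2; have [i'max|i'max] := eqVneq i' ord_max;
    first by rewrite i'max -def_n.
  apply: (lt_trans _ n) => //; rewrite def_n; apply: u_lt.
  by rewrite ltn_neqAle i'max leq_ord.
- rewrite big_ord_recr /= !ext_max; apply/eqP; rewrite -subr_eq; apply/eqP.
  by rewrite def_f; apply: eq_bigr => i _; rewrite !ext_widen.
- by rewrite ext_max.
Qed.

Lemma is_LM_lead f m : is_LM B lt f m -> lead f m.
Proof.
move=> [n [l [u [lB u_lt -> ->]]]]; split; first by have [] := lB ord_max.
exists (l ord_max); first by have [] := lB ord_max.
rewrite big_ord_recr /= addrK; apply: (big_ind (lin_span _)).
- exact: lin_span0.
- exact: lin_spanD.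
move=> i _; apply/lin_spanZ/lin_span_mem; split;
  first by have [] := lB (widen_ord (leqnSn n) i).
by apply: u_lt; rewrite /= ltn_ord.
Qed.

Lemma LM_lead f m : lead f m -> LM B lt f = m.
Proof.
move=> fm; apply: xget_unique => [|y /is_LM_lead fy]; first exact: lead_is_LM.
exact: lead_unique fy fm.
Qed.

Lemma lead_LM f : f <> 0 -> lead f (LM B lt f).
Proof. by move=> /lead_exists[m fm]; rewrite (LM_lead fm). Qed.

(** The condition on 1 is asked only when there is a nonzero element, so that the zero algebra,
    whose basis is empty, is covered. *)
Lemma groebner_theory_of_one (sd : side) :
    monomial_ordering B lt sd -> (forall f : A, f <> 0 -> B 1) ->
  has_groebner_theory B lt sd.
Proof.
move=> mo B1; split=> // J idJ _; exists J.
  apply/seteqP; split=> [x|x Jx I [_ JI]]; last exact: JI.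
  by move=> /(_ J); apply; split.
move=> f Jf f0; exists f => //.
have {}B1 := B1 f f0; have LMB : B (LM B lt f) by have [] := lead_LM f0.
have LMK : LM B lt (LM B lt f) = LM B lt f by apply/LM_lead/lead_self.
by case: sd {mo idJ}; [exists 1|exists 1|exists 1, 1]; split;
  rewrite ?mul1r ?mulr1.
Qed.

End LeadingMonomials.

(** * Ideals and linear reduction modulo an ideal *)

Section IdealTheory.
Variables (K : fieldType) (A : kalgType K) (J : set A).
Hypothesis idJ : is_ideal TwoSided J.

Lemma in_ideal0 : J 0. Proof. by case: idJ. Qed.

Lemma in_idealB x y : J x -> J y -> J (x - y).
Proof. by case: idJ => _ + _; apply. Qed.

Lemma in_idealD x y : J x -> J y -> J (x + y).
Proof.
move=> Jx Jy; rewrite -[y]opprK; apply: in_idealB => //.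
by rewrite -sub0r; apply: in_idealB => //; apply: in_ideal0.
Qed.

Lemma in_idealMl a x : J x -> J (a * x).
Proof. by case: idJ => _ _ JM /(JM a)[]. Qed.

Lemma in_idealMr a x : J x -> J (x * a).
Proof. by case: idJ => _ _ JM /(JM a)[]. Qed.

Lemma in_idealZ k x : J x -> J (k *: x).
Proof. by move=> Jx; rewrite -[x]mul1r kalg_scalerAl; apply: in_idealMl. Qed.

Lemma in_idealZE k x : k != 0 -> J (k *: x) -> J x.
Proof. by move=> k0 /(in_idealZ k^-1); rewrite scalerA mulVf // scale1r. Qed.

Lemma lin_span_mod (S P : set A) x :
    (forall u, S u -> exists2 y, lin_span P y & J (u - y)) ->
  lin_span S x -> exists2 y, lin_span P y & J (x - y).
Proof.
move=> SP; move: x.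
apply: lin_span_sub => [|x z [x' Px Jx] [z' Pz Jz]|k x [x' Px Jx]|//].
- by exists 0; [apply: lin_span0|rewrite subrr; apply: in_ideal0].
- by exists (x' + z'); [apply: lin_spanD|rewrite opprD addrACA;
    apply: in_idealD].
- by exists (k *: x'); [apply: lin_spanZ|rewrite -scalerBr; apply: in_idealZ].
Qed.

Lemma generated_min (S : set A) : S `<=` J -> generated TwoSided S `<=` J.
Proof. by move=> SJ x; apply. Qed.

End IdealTheory.

Lemma sub_generated (K : fieldType) (A : kalgType K) (S : set A) :
  S `<=` generated TwoSided S.
Proof. by move=> x Sx J [_]; apply. Qed.

(** * Bases of a quotient algebra *)

Section QuotientBasis.
Variables (K : fieldType) (A : kalgType K) (I : ideal A) (N : set A).
Hypotheses (indN : lin_indep N) (spanN0 : forall x, lin_span N x ->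
  ideal_set I x -> x = 0).

Lemma proj_eq0 x : proj I x = 0 <-> ideal_set I x.
Proof. by rewrite -(raddf0 (proj I)) proj_eq subr0. Qed.

Lemma proj_span_inj x y : lin_span N x -> lin_span N y -> proj I x = proj I y ->
  x = y.
Proof.
move=> Nx Ny /proj_eq Ixy; apply/eqP; rewrite -subr_eq0; apply/eqP/spanN0 => //.
exact: lin_spanB.
Qed.

Lemma proj_inj_on x y : N x -> N y -> proj I x = proj I y -> x = y.
Proof. by move=> Nx Ny; apply: proj_span_inj; apply: lin_span_mem. Qed.

Lemma lin_span_proj (S : set A) x : lin_span S x ->
  lin_span (proj I @` S) (proj I x).
Proof.
move=> [s [sS ->]]; exists [seq (p.1, proj I p.2) | p <- s]; split.
  by move=> _ /mapP[p /sS Sp ->]; exists p.2.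
by rewrite raddf_sum big_map; apply: eq_bigr => p _ /=;
  rewrite proj_is_scalable.
Qed.

(** A relation between classes lifts to a combination of representatives in [N]. It lies in [I], so
    it vanishes by [spanN0], and independence of [N] applies. *)
Lemma quot_basis : (forall x, exists2 y, lin_span N y & ideal_set I (x - y)) ->
  is_basis (proj I @` N).
Proof.
move=> decN; split=> [s c s_uniq sN sum0 q sq|]; last first.
  apply/seteqP; split=> // q _; have [x <-] := proj_surj q.
  have [y Ny /proj_eq ->] := decN x; exact: lin_span_proj.
pose rep q := xget 0 [set u | N u /\ proj I u = q].
have repP p : p \in s -> N (rep p) /\ proj I (rep p) = p.
  move=> /sN[u Nu def_p]; rewrite /rep; case: xgetP => [v _ []//|].
  by move=> /(_ u)[].
have := @indN (map rep s) (fun u => c (proj I u)).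
rewrite map_inj_in_uniq =>
  [/(_ s_uniq) H|x y /repP[_ {2}<-] /repP[_ {2}<-] ->//].
rewrite -(repP q sq).2; apply: H; last exact: map_f.
  by move=> _ /mapP[p /repP[Np _] ->].
apply: spanN0.
  exists [seq (c p, rep p) | p <- s]; split.
    by move=> _ /mapP[p /repP[Np _] ->].
  rewrite !big_map; apply: eq_big_seq => p /repP[_ ->] //.
apply/proj_eq0; rewrite raddf_sum big_map -[RHS]sum0;
  apply: eq_big_seq => p /repP[_ ep].
by rewrite /= proj_is_scalable ep.
Qed.

End QuotientBasis.

(** * Homogeneous components in a graded algebra *)

Section GradationTheory.
Variables (K : fieldType) (d : Order.disp_t) (Gamma : osemigroupType d).
Variables (A : kalgType K) (gr : Gamma -> set A).
Hypothesis grA : gradation gr.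

Let grZD g k x y : gr g x -> gr g y -> gr g (k *: x + y).
Proof. by case: grA => /(_ g)[_ +] _ _ _; apply. Qed.

Lemma gr0 g : gr g 0. Proof. by case: grA => /(_ g)[]. Qed.

Lemma grZ g k x : gr g x -> gr g (k *: x).
Proof. by move=> gx; rewrite -[_ *: _]addr0; apply/grZD/gr0. Qed.

Lemma grD g x y : gr g x -> gr g y -> gr g (x + y).
Proof. by move=> gx gy; rewrite -[x]scale1r; apply: grZD. Qed.

Lemma grM g h x y : gr g x -> gr h y -> gr (g * h)%g (x * y).
Proof. by case: grA => _ + _ _; apply. Qed.

(** A decomposition is a function on all of [Gamma] vanishing off a finite list, so that two
    decompositions can be added and subtracted pointwise. *)
Let decomp x (c : Gamma -> A) := (forall g, gr g (c g)) /\
  exists s : seq Gamma, [/\ uniq s, forall g, g \notin s ->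
    c g = 0 & x = \sum_(g <- s) c g].

Let decomp_sum x c s' : decomp x c -> uniq s' -> (forall g, g \notin s' ->
  c g = 0) ->
  x = \sum_(g <- s') c g.
Proof.
move=> [_ [s [s_uniq s0 ->]]] s'_uniq s'0.
rewrite (bigID (fun g => g \in s')) /= [X in _ + X]big1 => [|g /s'0//].
rewrite addr0 [RHS](bigID (fun g => g \in s)) /= [X in _ + X]big1 => [|g /s0//].
rewrite addr0 -big_filter -[RHS]big_filter; apply: perm_big; apply: uniq_perm;
  rewrite ?filter_uniq //.
by move=> g; rewrite !mem_filter andbC.
Qed.

Let decomp_exists x : exists c, decomp x c.
Proof.
have [_ _ /(_ x)[s [r [s_uniq gr_r ->]]] _] := grA.
exists (fun g => if g \in s then r g else 0); split=> [g|].
  by case: ifP => [/gr_r//|_]; apply: gr0.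
exists s; split=> // [g /negPf->//|].
by apply: eq_big_seq => g ->.
Qed.

Let decompB x y k c e : decomp x c -> decomp y e ->
  decomp (k *: x + y) (fun g => k *: c g + e g).
Proof.
move=> dx dy; split=> [g|]; first by apply: grZD; [case: dx|case: dy].
have [[_ [s [s_uniq s0 _]]] [_ [t [t_uniq t0 _]]]] := (dx, dy).
exists (undup (s ++ t)); split=> [|g|]; first exact: undup_uniq.
  rewrite mem_undup mem_cat negb_or => /andP[/s0-> /t0->].
  by rewrite scaler0 addr0.
rewrite big_split -scaler_sumr /=; congr (_ *: _ + _); apply: decomp_sum => //;
  rewrite ?undup_uniq // => g; rewrite mem_undup mem_cat negb_or.
- by case/andP => /s0.
- by case/andP => _ /t0.
Qed.

(** The difference of two decompositions decomposes 0, and the sum of the [gr g] is direct. *)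
Let decomp_unique x c e : decomp x c -> decomp x e -> c = e.
Proof.
move=> dc de; have := decompB (-1) dc de; rewrite scaleN1r addNr.
set f := fun g => _ => -[gr_f [s [s_uniq s0 /esym sum0]]].
have [_ _ _ /(_ s f s_uniq (fun g _ => gr_f g) sum0) f0] := grA.
apply/funext => g; apply/eqP; rewrite eq_sym -subr_eq0 addrC -scaleN1r.
by apply/eqP; have [/f0//|/s0//] := boolP (g \in s).
Qed.

(** Every element has a decomposition, so the default [fun=> 0] is never taken. *)
Definition hcomp (g : Gamma) (x : A) : A := xget (fun=> 0) (decomp x) g.

Let decomp_hcomp x : decomp x (hcomp^~ x).
Proof.
have [c dc] := decomp_exists x.
rewrite (_ : hcomp^~ x = c) //; apply/funext => g; rewrite /hcomp.
by rewrite (xget_unique _ dc) // => e de; apply: decomp_unique de dc.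
Qed.

Lemma gr_hcomp g x : gr g (hcomp g x). Proof. by case: (decomp_hcomp x). Qed.

Lemma hcomp_sum x : exists s : seq Gamma,
  [/\ uniq s, forall g, g \notin s ->
    hcomp g x = 0 & x = \sum_(g <- s) hcomp g x].
Proof. by case: (decomp_hcomp x). Qed.

Lemma hcomp_is_linear g : linear (hcomp g).
Proof.
move=> k x y; have := decomp_unique (decomp_hcomp (k *: x + y))
  (decompB k (decomp_hcomp x) (decomp_hcomp y)).
by move=> /(congr1 (fun c => c g)).
Qed.

HB.instance Definition _ g :=
  GRing.isLinear.Build K A A *:%R (hcomp g) (hcomp_is_linear g).

Lemma hcomp0 g : hcomp g 0 = 0. Proof. exact: linear0. Qed.

Lemma hcompD g x y : hcomp g (x + y) = hcomp g x + hcomp g y.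
Proof. exact: linearD. Qed.

Lemma hcompB g x y : hcomp g (x - y) = hcomp g x - hcomp g y.
Proof. exact: linearB. Qed.

Lemma hcompZ g k x : hcomp g (k *: x) = k *: hcomp g x.
Proof. exact: linearZ. Qed.

Lemma hcomp_bigsum g (T : Type) (s : seq T) (F : T -> A) :
  hcomp g (\sum_(i <- s) F i) = \sum_(i <- s) hcomp g (F i).
Proof. exact: linear_sum. Qed.

Lemma hcomp_gr g h x : gr h x -> hcomp g x = if g == h then x else 0.
Proof.
move=> hx; have : decomp x (fun g => if g == h then x else 0).
  split=> [k|]; first by case: eqP => [->//|_]; apply: gr0.
  exists [:: h]; split=> // [k|]; first by rewrite inE => /negPf->.
  by rewrite big_seq1 eqxx.
by move=> /(decomp_unique (decomp_hcomp x))/(congr1 (fun c => c g)).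
Qed.

Lemma gr_inj g h x : gr g x -> gr h x -> x <> 0 -> g = h.
Proof.
move=> gx hx x0; have := hcomp_gr g hx; rewrite (hcomp_gr g gx) eqxx.
by case: eqP.
Qed.

(** Strict monotonicity and totality make an ordered semigroup cancellative. *)
Lemma osemi_mulIl (g h k : Gamma) : ((g * h)%g == (g * k)%g) = (h == k).
Proof.
apply/eqP/eqP => [|->//]; have [hk|kh|//] := ltgtP h k => eq_gh.
  by have := osemi_ltl g _ _ hk; rewrite eq_gh ltxx.
by have := osemi_ltl g _ _ kh; rewrite eq_gh ltxx.
Qed.

Lemma osemi_mulIr (g h k : Gamma) : ((h * g)%g == (k * g)%g) = (h == k).
Proof.
apply/eqP/eqP => [|->//]; have [hk|kh|//] := ltgtP h k => eq_gh.
  by have := osemi_ltr g _ _ hk; rewrite eq_gh ltxx.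
by have := osemi_ltr g _ _ kh; rewrite eq_gh ltxx.
Qed.

(* [g * h] is the degree of no [a * hcomp k x] with [k <> h], as [Gamma] is
   cancellative. *)
Lemma hcompMl a g h x : gr g a -> hcomp (g * h)%g (a * x) = a * hcomp h x.
Proof.
move=> ga; have [s [s_uniq s0 {1}->]] := hcomp_sum x.
rewrite mulr_sumr linear_sum /=.
under eq_bigr => k _ do rewrite (hcomp_gr _ (grM ga (gr_hcomp k x)))
  osemi_mulIl.
rewrite -big_mkcond /=; have [sh|s'h] := boolP (h \in s).
  by rewrite -big_filter (@eq_filter _ _ (pred1 h)) ?filter_pred1_uniq ?big_seq1
    // => k /=.
rewrite s0 // mulr0 big_seq_cond big1 // => k /andP[sk /eqP hk].
by rewrite hk sk in s'h.
Qed.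

Lemma hcompMr a g h x : gr g a -> hcomp (h * g)%g (x * a) = hcomp h x * a.
Proof.
move=> ga; have [s [s_uniq s0 {1}->]] := hcomp_sum x.
rewrite mulr_suml linear_sum /=.
under eq_bigr => k _ do rewrite (hcomp_gr _ (grM (gr_hcomp k x) ga))
  osemi_mulIr.
rewrite -big_mkcond /=; have [sh|s'h] := boolP (h \in s).
  by rewrite -big_filter (@eq_filter _ _ (pred1 h)) ?filter_pred1_uniq ?big_seq1
    // => k /=.
rewrite s0 // mul0r big_seq_cond big1 // => k /andP[sk /eqP hk].
by rewrite hk sk in s'h.
Qed.

Lemma hcompM g x y : exists s t : seq Gamma,
  hcomp g (x * y) = \sum_(h <- s) \sum_(k <- t | g == (h * k)%g) hcomp h x *
    hcomp k y.
Proof.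
have [[s [_ _ def_x]] [t [_ _ def_y]]] := (hcomp_sum x, hcomp_sum y).
exists s, t; rewrite {1}def_x mulr_suml linear_sum; apply: eq_bigr => h _ /=.
rewrite {1}def_y mulr_sumr linear_sum [RHS]big_mkcond; apply: eq_bigr => k _ /=.
by rewrite (hcomp_gr _ (grM (gr_hcomp h x) (gr_hcomp k y))).
Qed.

Definition deg_le (g : Gamma) : set A :=
  [set x | forall h, (g < h)%O -> hcomp h x = 0].

Definition deg_lt (g : Gamma) : set A :=
  [set x | forall h, (g <= h)%O -> hcomp h x = 0].

Lemma deg_le0 g : deg_le g 0. Proof. by move=> h _; rewrite hcomp0. Qed.

Lemma deg_leZD g k x y : deg_le g x -> deg_le g y -> deg_le g (k *: x + y).
Proof. by move=> gx gy h gh; rewrite linearP /= gx // gy // scaler0 addr0. Qed.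

Lemma deg_le_mono g h x : (g <= h)%O -> gr g x -> deg_le h x.
Proof.
move=> gh gx k hk; rewrite (hcomp_gr _ gx); case: eqP => // kg.
by have := le_lt_trans gh hk; rewrite kg ltxx.
Qed.

Lemma deg_leMl a g h x : gr g a -> deg_le h x -> deg_le (g * h)%g (a * x).
Proof.
move=> ga hx k ghk; have [s [_ _ def_x]] := hcomp_sum x.
rewrite {1}def_x mulr_sumr linear_sum big1 // => l _ /=.
rewrite (hcomp_gr _ (grM ga (gr_hcomp l x))); case: eqP => // def_k.
rewrite hx ?mulr0 //; rewrite ltNge; apply/negP => lh.
have : ((g * l)%g <= (g * h)%g)%O.
  by move: lh; rewrite le_eqVlt => /predU1P[->//|/(osemi_ltl g _ _)/ltW].
by rewrite -def_k => /le_lt_trans/(_ ghk); rewrite ltxx.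
Qed.

Lemma deg_leMr a g h x : gr g a -> deg_le h x -> deg_le (h * g)%g (x * a).
Proof.
move=> ga hx k ghk; have [s [_ _ def_x]] := hcomp_sum x.
rewrite {1}def_x mulr_suml linear_sum big1 // => l _ /=.
rewrite (hcomp_gr _ (grM (gr_hcomp l x) ga)); case: eqP => // def_k.
rewrite hx ?mul0r //; rewrite ltNge; apply/negP => lh.
have : ((l * g)%g <= (h * g)%g)%O.
  by move: lh; rewrite le_eqVlt => /predU1P[->//|/(osemi_ltr g _ _)/ltW].
by rewrite -def_k => /le_lt_trans/(_ ghk); rewrite ltxx.
Qed.

(** At this degree [LH] is the component [hcomp g x], which frees later arguments from sorted
    sums. *)
Definition top_degree (x : A) (g : Gamma) := hcomp g x <> 0 /\ deg_le g x.

Lemma top_degree_unique x g h : top_degree x g -> top_degree x h -> g = h.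
Proof.
by move=> [xg gx] [xh hx]; have [/gx|/hx|//] := ltgtP g h.
Qed.

Lemma is_LH_top x h : is_LH gr x h -> exists2 g, top_degree x g & h = hcomp g x.
Proof.
move=> [n [g [r [gr_r g_lt def_x ->]]]].
have xE k : hcomp k x = \sum_i (if k == g i then r i else 0).
  by rewrite def_x linear_sum; apply: eq_bigr => i _ /=;
    rewrite (hcomp_gr _ (gr_r i).1).
have top : hcomp (g ord_max) x = r ord_max.
  rewrite xE big_ord_recr /= eqxx big1 ?add0r // => i _.
  have /g_lt : (widen_ord (leqnSn n) i < @ord_max n)%N by rewrite /= ltn_ord.
  by case: eqP => // ->; rewrite ltxx.
exists (g ord_max) => //; split=> [|k gk]; first by rewrite top;
  case: (gr_r ord_max).
rewrite xE big1 // => i _; case: eqP => // def_k.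
have : (g i <= g ord_max)%O.
  have [->//|i_max] := eqVneq i ord_max.
  by apply/ltW/g_lt; rewrite ltn_neqAle i_max leq_ord.
by rewrite -def_k => /le_lt_trans/(_ gk); rewrite ltxx.
Qed.

Lemma is_LH_exists x : x <> 0 -> exists h, is_LH gr x h.
Proof.
move=> x0; have [s [s_uniq s0 def_x]] := hcomp_sum x.
(* The list [s] may contain degrees whose component is 0; these are dropped before sorting. *)
pose t := sort <=%O [seq g <- s | hcomp g x != 0].
have t_lt : sorted <%O t.
  by rewrite lt_sorted_uniq_le sort_uniq filter_uniq //= sort_sorted //;
    apply: le_total.
have t_mem g : (g \in t) = (g \in s) && (hcomp g x != 0).
  by rewrite mem_sort mem_filter andbC.
have def_x' : x = \sum_(g <- t) hcomp g x.
  rewrite (perm_big [seq g <- s | hcomp g x != 0]) /=;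
    last by rewrite perm_sort.
  rewrite big_filter {1}def_x [LHS](bigID (fun g => hcomp g x != 0)) /=.
  by rewrite [X in _ + X]big1 ?addr0 // => g; rewrite negbK => /eqP.
case: t t_lt t_mem def_x' => [|g0 t'] t_lt t_mem def_x'.
  by rewrite big_nil in def_x'.
set t := g0 :: t' in t_lt t_mem def_x'.
pose g (i : 'I_(size t').+1) := nth g0 t i.
exists (hcomp (g ord_max) x), (size t'), g, (fun i => hcomp (g i) x);
  split=> //.
- move=> i; split; first exact: gr_hcomp.
  have : g i \in t by rewrite mem_nth.
  by rewrite t_mem => /andP[_ /eqP].
- by move=> i j ij; rewrite lt_sorted_ltn_nth // inE.
- by rewrite {1}def_x' (big_nth g0) big_mkord.
Qed.

Lemma top_degree_exists x : x <> 0 -> exists g, top_degree x g.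
Proof. by move=> /is_LH_exists[h /is_LH_top[g]]; exists g. Qed.

Lemma LH_top x g : top_degree x g -> LH gr x = hcomp g x.
Proof.
move=> xg; have [|h xh] := @is_LH_exists x.
  by move=> x0; case: xg => + _; rewrite x0 linear0.
apply: xget_unique => [|k /is_LH_top[g' xg' ->]];
  last by rewrite (top_degree_unique xg xg').
by have [g' xg' def_h] := is_LH_top xh;
  rewrite (top_degree_unique xg xg') -def_h.
Qed.

Lemma LH0 : LH gr 0 = 0.
Proof. by apply: xgetPN => h /is_LH_top[g []]; rewrite linear0. Qed.

End GradationTheory.

(** * Products of monomials and the monomial ordering *)

Section SkewMonomials.
Variables (K : fieldType) (R : kalgType K) (gens : seq R) (B : set R).
Variable lt : R -> R -> Prop.
Hypotheses (skewB : skew_multiplicative_basis gens B).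
Hypothesis admB : admissible_system B lt TwoSided.

Let basisB : is_basis B := admB.1.
Let indB : lin_indep B := basisB.1.
Let wo : well_ordering B lt. Proof. by case: admB => _ []. Qed.

Lemma monomial_mul u v : B u -> B v ->
  u * v = 0 \/ exists l w, [/\ l != 0, B w & u * v = l *: w].
Proof. by case: skewB => _ _; apply. Qed.

Lemma monomial_mul3 u v w : B u -> B v -> B w ->
  u * v * w = 0 \/ exists l x, [/\ l != 0, B x & u * v * w = l *: x].
Proof.
move=> Bu Bv Bw; have [->|[l [x [l0 Bx ->]]]] := monomial_mul Bu Bv.
  by left; rewrite mul0r.
have [xw0|[k [y [k0 By xw]]]] := monomial_mul Bx Bw; rewrite -kalg_scalerAl.
  by left; rewrite xw0 scaler0.
by right; exists (l * k), y; rewrite xw scalerA mulf_neq0.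
Qed.

Lemma monomial_lt_mul u w v s l : B u -> B v -> B s -> B w -> l != 0 ->
  v <> 1 \/ s <> 1 -> v * u * s = l *: w -> lt u w.
Proof.
move=> Bu Bv Bs Bw l0 vs1 def_w.
have [_ [_ _ inc]] := admB; apply: (inc u w v s) => //.
by rewrite def_w (LM_lead basisB wo (lead_scale _ Bw l0)).
Qed.

(* If [1] were not a monomial, [u = 1 * u * 1] would be a combination of
   products [x * u * y], all of which are larger than [u]. *)
Lemma monomial_one u : B u -> B 1.
Proof.
move=> Bu; apply: contrapT => B'1.
have neq1 v : B v -> v <> 1 by move=> + v1; rewrite v1.
suff H x : lin_span [set v | B v /\ lt u v] (x * u * 1).
  have := H 1; rewrite mulr1 mul1r => /(lin_indep_sub indB)[].
  - by move=> ? [].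
  - by [].
  - by case: wo => + _ _ _ => /(_ u Bu).
have := basis_span basisB 1; move: (1 : R).
apply: lin_span_sub => [|y z|k y|y By].
- by rewrite mulr0; apply: lin_span0.
- by rewrite mulrDr; apply: lin_spanD.
- by rewrite -kalg_scalerAr; apply: lin_spanZ.
have := basis_span basisB x; move: x.
apply: lin_span_sub => [|x z|k x|x Bx].
- by rewrite !mul0r; apply: lin_span0.
- by rewrite !mulrDl; apply: lin_spanD.
- by rewrite -!kalg_scalerAl; apply: lin_spanZ.
have [->|[l [w [l0 Bw def_w]]]] := monomial_mul3 Bx Bu By;
  first exact: lin_span0.
rewrite def_w; apply/lin_spanZ/lin_span_mem; split=> //.
by apply: monomial_lt_mul def_w => //; left; apply: neq1.
Qed.

(** A monomial [u] other than 1 is the proper multiple [u * 1 * 1] of 1. *)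
Lemma monomial_one_min u : B u -> u = 1 \/ lt 1 u.
Proof.
move=> Bu; have B1 := monomial_one Bu.
have [->|/eqP u1] := eqVneq u 1; [by left|right].
apply: (@monomial_lt_mul 1 u u 1 1) => //; rewrite ?oner_neq0 //; first by left.
by rewrite !mulr1 scale1r.
Qed.

Lemma monomial_not_lt1 u : B u -> ~ lt u 1.
Proof.
have [lt_irr lt_trans _ _] := wo; move=> Bu u_lt1; have B1 := monomial_one Bu.
have [u1|lt1u] := monomial_one_min Bu; first by apply: (lt_irr 1) => //;
  rewrite {1}u1 in u_lt1.
exact/(lt_irr 1)/(lt_trans 1 u 1).
Qed.

(** Unless [v = s = 1], the ordering would give [lt u 1], but no monomial is below 1. *)
Lemma monomial_mul_eq1 v u s (l : K) : B u -> B v -> B s -> l != 0 ->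
  v * u * s = l *: (1 : R) -> [/\ v = 1, u = 1 & s = 1].
Proof.
move=> Bu Bv Bs l0 def1; have B1 := monomial_one Bu.
have [v1 s1] : v = 1 /\ s = 1.
  apply: contrapT => vs1; apply: (monomial_not_lt1 Bu).
  apply: monomial_lt_mul def1 => //.
  by have [v1|/eqP] := eqVneq v 1; [right=> s1; apply: vs1|left].
by split=> //; apply: (lin_indep_eq_scale indB Bu B1 (k := l));
  rewrite -def1 v1 s1 mulr1 mul1r.
Qed.

(** Compatibility freed from its proviso on scalars: if either product is a scalar, then
    [v = s = 1], so [u' = u] and [w' = w]. *)
Lemma monomial_mul_homo u w v s l k u' w' :
    B u -> B w -> B v -> B s -> B u' -> B w' -> l != 0 -> k != 0 ->
    v * u * s = l *: u' -> v * w * s = k *: w' ->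
  lt u w -> lt u' w'.
Proof.
move=> Bu Bw Bv Bs Bu' Bw' l0 k0 def_u' def_w' uw; have B1 := monomial_one Bu.
have LMu : LM B lt (v * u * s) = u'.
  by rewrite def_u' (LM_lead basisB wo (lead_scale _ Bu' l0)).
have LMw : LM B lt (v * w * s) = w'.
  by rewrite def_w' (LM_lead basisB wo (lead_scale _ Bw' k0)).
have not1 x : B x -> x <> 1 -> ~ in_scalars x.
  by move=> Bx x1 [c /(lin_indep_eq_scale indB Bx B1)].
have unit_vs : v = 1 -> s = 1 -> u' = u /\ w' = w.
  move=> v1 s1; rewrite v1 s1 !mulr1 !mul1r in def_u' def_w'.
  by split; apply/esym; apply: (lin_indep_eq_scale indB) => //; eassumption.
have [u'1|/eqP u'1] := eqVneq u' 1.
  rewrite u'1 in def_u'; have [v1 _ s1] := monomial_mul_eq1 Bu Bv Bs l0 def_u'.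
  by have [-> ->] := unit_vs v1 s1.
have [w'1|/eqP w'1] := eqVneq w' 1.
  rewrite w'1 in def_w'; have [v1 _ s1] := monomial_mul_eq1 Bw Bv Bs k0 def_w'.
  by have [-> ->] := unit_vs v1 s1.
have [_ [_ comp _]] := admB; rewrite -LMu -LMw; apply: comp => //.
  by rewrite LMu; apply: not1.
by rewrite LMw; apply: not1.
Qed.

(** Multiplication by [v] and [s] sends each monomial below [m] to 0 or to a multiple of a monomial
    below [m']. *)
Lemma lead_mul f m v s m' l : lead B lt f m -> B v -> B s -> B m' -> l != 0 ->
  v * m * s = l *: m' -> lead B lt (v * f * s) m'.
Proof.
move=> [Bm [c c0 lowf]] Bv Bs Bm' l0 def_m'; split=> //.
exists (c * l); first by rewrite mulf_neq0.
rewrite -scalerA -def_m' kalg_scalerAl kalg_scalerAr -mulrBl -mulrBr.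
move: (f - _) lowf; apply: lin_span_sub => [|x y|k x|x [Bx xm]].
- by rewrite mulr0 mul0r; apply: lin_span0.
- by rewrite mulrDr mulrDl; apply: lin_spanD.
- by rewrite -kalg_scalerAr -kalg_scalerAl; apply: lin_spanZ.
have [->|[k [y [k0 By def_y]]]] := monomial_mul3 Bv Bx Bs;
  first exact: lin_span0.
rewrite def_y; apply/lin_spanZ/lin_span_mem; split=> //.
exact: (@monomial_mul_homo x m v s k l).
Qed.

(** * Normal monomials modulo an ideal *)

Section NormalMonomials.
Variables (I : ideal R).
Let N := normal_monomials B lt I.
Let le u v := u = v \/ lt u v.

Lemma normal_indep : lin_indep N.
Proof. by apply: lin_indepS indB => u []. Qed.

Lemma mdivides_refl u : B u -> mdivides B u u.
Proof.
move=> Bu; have B1 := monomial_one Bu; exists 1, 1, 1.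
by rewrite oner_neq0 scale1r mul1r mulr1.
Qed.

Lemma normal_lead f u : ideal_set I f -> lead B lt f u -> ~ N u.
Proof.
move=> If fu [Bu /(_ f If (lead_neq0 basisB wo fu))]; apply.
by rewrite (LM_lead basisB wo fu); apply: mdivides_refl.
Qed.

Lemma not_normal u : B u -> ~ N u ->
  exists2 f, ideal_set I f & f <> 0 /\ mdivides B (LM B lt f) u.
Proof.
move=> Bu nNu; apply: contrapT => H; apply: nNu; split=> // f If f0 fu.
by apply: H; exists f.
Qed.

(** Solving for [m] puts it in the span of [S] and the monomials below [m]. As a basis element it is
    one of these, so it is in [S]. *)
Lemma lead_in_span S x m : S `<=` B -> lin_span S x -> lead B lt x m -> S m.
Proof.
move=> SB Sx xm; have [Bm [c c0 lowx]] := xm.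
have : lin_span [set u | S u \/ B u /\ lt u m] m.
  rewrite -[X in lin_span _ X]scale1r -(mulVf c0) -scalerA; apply: lin_spanZ.
  rewrite -[c *: m](subKr x); apply: lin_spanB.
    by apply: lin_spanS Sx => u; left.
  by apply: lin_spanS lowx => u; right.
case/(lin_indep_sub indB) => //; first by move=> u [/SB|[]].
by case=> _ mm; case: wo => /(_ m Bm).
Qed.

(** [P] stands for both [I] and [<LH(I)>]: all that matters is that its leading monomials also lead
    elements of [I]. *)
Lemma normal_span0 (P : set R) x :
    (forall f m, P f -> lead B lt f m ->
      exists2 g, ideal_set I g & lead B lt g m) ->
  lin_span N x -> P x -> x = 0.
Proof.
move=> leadP Nx Px; apply: contrapT => /(lead_exists basisB wo)[m xm].
have [g Ig gm] := leadP _ _ Px xm.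
by apply: (normal_lead Ig gm); apply: lead_in_span Nx xm => u [].
Qed.

(** Division: a non-normal [w] leads some [a * f * b] in [I], which trades [w] for smaller
    monomials. The bound [le n w] is recorded because it later bounds degrees. *)
Lemma normal_reduction w : B w ->
  exists2 x, lin_span [set n | N n /\ le n w] x & ideal_set I (w - x).
Proof.
move: w; apply: (well_ordering_ind wo) => w Bw IH.
have [Nw|nNw] := pselect (N w).
  exists w; first by apply: lin_span_mem; split=> //; left.
  by rewrite subrr; apply: in_ideal0 (idealP I).
have [f If [f0 [l [a [b [l0 Ba Bb def_w]]]]]] := not_normal Bw nNw.
have fm := lead_LM basisB wo f0; set m := LM B lt f in fm def_w.
have def_w' : a * m * b = l^-1 *: w by rewrite def_w scalerA mulVf // scale1r.
have l'0 : l^-1 != 0 by rewrite invr_eq0.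
have [_ [c c0 low]] := lead_mul fm Ba Bb Bw l'0 def_w'.
have {}If : ideal_set I (c^-1 *: (a * f * b)).
  by apply: in_idealZ; [exact: idealP|apply: in_idealMr;
    [exact: idealP|apply: in_idealMl; [exact: idealP|]]].
suff [x Nx Ix] : exists2 x, lin_span [set n | N n /\ le n w] x &
    ideal_set I (a * f * b - c *: w - x).
  exists ((- c^-1) *: x); first exact: lin_spanZ.
  have -> : w - (- c^-1) *: x = c^-1 *: (a * f * b) - c^-1 *: (a * f * b - c *:
    w - x).
    rewrite !scalerBr scalerA mulVf // scale1r scaleNr opprK.
    by rewrite -[_ - w - _]addrA -opprD subKr.
  by apply: in_idealB => //; [exact: idealP|apply: in_idealZ => //;
    exact: idealP].
apply: (lin_span_mod (idealP I)) low => u [Bu uw].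
have [x Nx Ix] := IH u Bu uw; exists x => //; apply: lin_spanS Nx => n [Nn nu].
split=> //; right; case: nu => [->//|nu].
by have [_ lt_trans _ _] := wo; apply: lt_trans uw => //; case: Nn.
Qed.

End NormalMonomials.

End SkewMonomials.

(** * The ideal generated by the leading homogeneous parts *)

Section LeadingHomogeneousIdeal.
Variables (K : fieldType) (d : Order.disp_t) (Gamma : osemigroupType d).
Variables (R : kalgType K) (gr : Gamma -> set R) (I : ideal R).
Hypothesis grR : gradation gr.
Let J := LH_ideal gr I.
Let idI := idealP I.
Let idJ := idealP J.

Lemma LH_ideal_mem f : ideal_set I f -> ideal_set J (LH gr f).
Proof. by move=> If; apply: sub_generated; exists f. Qed.

(* The set of all [x] with this property is an ideal that contains [LH(I)]. *)
Lemma LH_ideal_hcomp x g : ideal_set J x ->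
  exists f, [/\ ideal_set I f, deg_le gr g f & hcomp gr g f = hcomp gr g x].
Proof.
pose P : set R := [set x | forall g, exists f,
  [/\ ideal_set I f, deg_le gr g f & hcomp gr g f = hcomp gr g x]].
suff idP : is_ideal TwoSided P.
  move=> /(generated_min idP) H; apply: H => _ [f If <-] k0.
  have [->|/(top_degree_exists grR)[k fk]] := pselect (f = 0).
    by exists 0; rewrite (LH0 grR); split;
      [exact: in_ideal0 idI|exact: deg_le0|].
  rewrite (LH_top grR fk) (hcomp_gr grR _ (gr_hcomp grR k f)).
  (* [LH gr f] is concentrated in the top degree of [f], where [f] itself is a witness; in other
     degrees 0 is one. *)
  case: eqP => [->|_]; first by exists f; split=> //; case: fk.
  by exists 0; split; [exact: in_ideal0 idI|exact: deg_le0|exact: hcomp0].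
have Psum (T : eqType) (s : seq T) h (F : T -> R) : (forall i, i \in s ->
  exists f,
    [/\ ideal_set I f, deg_le gr h f & hcomp gr h f = F i]) ->
    exists f, [/\ ideal_set I f,
      deg_le gr h f & hcomp gr h f = \sum_(i <- s) F i].
  move=> H; rewrite big_seq; apply: (big_ind (fun y => exists f,
      [/\ ideal_set I f, deg_le gr h f & hcomp gr h f = y])) => //.
    by exists 0; split; [exact: in_ideal0 idI|exact: deg_le0|exact: hcomp0].
  move=> _ _ [f [If fh <-]] [f' [If' f'h <-]]; exists (f + f');
    rewrite (hcompD grR); split=> //.
    exact: in_idealD.
  by rewrite -[f]scale1r; apply: deg_leZD.
(* A component of a product is a finite sum of products of components, so pairs of components
   suffice. *)
have PM x1 x2 h : (forall k l, exists f, [/\ ideal_set I f,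
  deg_le gr (k * l)%g f &
    hcomp gr (k * l)%g f = hcomp gr k x1 * hcomp gr l x2]) ->
    exists f, [/\ ideal_set I f,
      deg_le gr h f & hcomp gr h f = hcomp gr h (x1 * x2)].
  move=> H; have [s [t ->]] := hcompM grR h x1 x2.
  apply: (Psum) => k _; rewrite -big_filter; apply: (Psum) => l.
  by rewrite mem_filter => /andP[/eqP-> _].
split=> [h|y z Py Pz h|a y Py].
- by exists 0; split; [exact: in_ideal0 idI|exact: deg_le0|].
- rewrite (hcompB grR); have [[f [If fh <-]] [f' [If' f'h <-]]] := (Py h, Pz h).
  exists (f - f'); rewrite (hcompB grR); split=> //; first exact: in_idealB.
  by rewrite addrC -scaleN1r; apply: deg_leZD.
- split=> h; apply: (PM) => k l.
    have [f [If fl <-]] := Py l; exists (hcomp gr k a * f).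
    have ga := gr_hcomp grR k a; split; first exact: in_idealMl.
      exact: deg_leMl.
    exact: hcompMl.
  have [f [If fk <-]] := Py k; exists (f * hcomp gr l a).
  have ga := gr_hcomp grR l a; split; first exact: in_idealMr.
    exact: deg_leMr.
  exact: hcompMr.
Qed.

(** A nonzero component of [x] is the top component of some [f] in [I], that is, [LH gr f]. *)
Lemma LH_ideal_graded x g : ideal_set J x -> ideal_set J (hcomp gr g x).
Proof.
move=> /(LH_ideal_hcomp g)[f [If fg <-]].
have [->|f0] := pselect (hcomp gr g f = 0); first exact: in_ideal0 idJ.
have top : top_degree gr f g by [].
by rewrite -(LH_top grR top); apply: LH_ideal_mem.
Qed.

Lemma graded_LH_ideal : graded_ideal gr J.
Proof.
split=> // s r s_uniq gr_r Jsum g sg.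
suff <- : hcomp gr g (\sum_(h <- s) r h) = r g by apply: LH_ideal_graded.
rewrite (hcomp_bigsum grR) (bigD1_seq g) //= (hcomp_gr grR _ (gr_r g sg)) eqxx.
rewrite big_seq_cond big1 ?addr0 // => h /andP[sh hg].
by rewrite (hcomp_gr grR _ (gr_r h sh)) eq_sym (negPf hg).
Qed.

End LeadingHomogeneousIdeal.

(** * Leading monomials and degrees under a graded ordering *)

Section GradedMonomials.
Variables (K : fieldType) (d : Order.disp_t) (Gamma : osemigroupType d).
Variables (R : kalgType K) (gr : Gamma -> set R) (gens : seq R) (B : set R).
Variables (lt : R -> R -> Prop) (I : ideal R).
Hypotheses (grR : gradation gr) (skewB : skew_multiplicative_basis gens B).
Hypothesis admB : admissible_system B lt TwoSided.
Hypothesis gr_lt : graded_monomial_ordering gr TwoSided B lt.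
Let J := LH_ideal gr I.
Let N := normal_monomials B lt I.
Let idI := idealP I.
Let idJ := idealP J.
Let basisB : is_basis B := admB.1.
Let indB : lin_indep B := basisB.1.
Let wo : well_ordering B lt. Proof. by case: admB => _ []. Qed.

Lemma monomial_degree u : B u -> exists g, gr g u.
Proof. by have [homB _ _] := gr_lt; move=> /homB. Qed.

Lemma monomial_lt_degree u v g h :
  B u -> B v -> gr g u -> gr h v -> lt u v -> (g <= h)%O.
Proof.
have [_ _ [lt' _ ltE]] := gr_lt;
  move=> Bu Bv gu hv /(ltE u v Bu Bv)[g' [h' [g'u h'v]]].
rewrite (gr_inj grR g'u gu (lin_indep_neq0 indB Bu)).
rewrite (gr_inj grR h'v hv (lin_indep_neq0 indB Bv)).
by move=> [/ltW//|[-> _]].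
Qed.

Lemma monomial_degree_lt u v g h :
  B u -> B v -> gr g u -> gr h v -> (g < h)%O -> lt u v.
Proof.
by have [_ _ [lt' _ ltE]] := gr_lt; move=> Bu Bv gu hv gh; apply/ltE => //;
  exists g, h; split=> //; left.
Qed.

Lemma deg_le_lower m g x : B m -> gr g m ->
  lin_span [set u | B u /\ lt u m] x -> deg_le gr g x.
Proof.
move=> Bm gm; move: x; apply: lin_span_sub => [h _|x y gx gy|k x gx|u [Bu um]].
- by rewrite (hcomp0 grR).
- by rewrite -[x]scale1r; apply: deg_leZD.
- by rewrite -[_ *: _]addr0; apply: deg_leZD => //; apply: deg_le0.
have [h hu] := monomial_degree Bu.
by apply: (deg_le_mono grR _ hu); apply: monomial_lt_degree um.
Qed.

(** Taking the component of degree [g] keeps [m] and keeps or kills each lower monomial. *)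
Lemma lead_hcomp f m g : gr g m -> lead B lt f m -> lead B lt (hcomp gr g f) m.
Proof.
move=> gm [Bm [c c0 low]]; split=> //; exists c => //.
have <- : hcomp gr g (f - c *: m) = hcomp gr g f - c *: m.
  by rewrite (hcompB grR) (hcompZ grR) (hcomp_gr grR g gm) eqxx.
move: (f - _) low; apply: lin_span_sub => [|x y|k x|u low_u].
- by rewrite (hcomp0 grR); apply: lin_span0.
- by rewrite (hcompD grR); apply: lin_spanD.
- by rewrite (hcompZ grR); apply: lin_spanZ.
have [h hu] := monomial_degree low_u.1; rewrite (hcomp_gr grR g hu).
by case: eqP => _; [apply: lin_span_mem|apply: lin_span0].
Qed.

Lemma lead_top_degree f m g : gr g m -> lead B lt f m -> top_degree gr f g.
Proof.
move=> gm fm; split; first exact: lead_neq0 basisB wo _ _ (lead_hcomp gm fm).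
have [Bm [c c0 low]] := fm; rewrite -(subrK (c *: m) f) addrC; apply: deg_leZD.
- by [].
- exact (deg_le_mono grR (lexx g) gm).
- exact: deg_le_lower Bm gm low.
Qed.

Lemma lead_LH f m : lead B lt f m -> exists g, [/\ gr g m, top_degree gr f g,
  LH gr f = hcomp gr g f & lead B lt (LH gr f) m].
Proof.
move=> fm; have [g gm] := monomial_degree fm.1;
  have fg := lead_top_degree gm fm.
by exists g; rewrite (LH_top grR fg); split=> //; apply: lead_hcomp.
Qed.

(** The leading monomial has the top degree of [x], and the monomials below it have no larger
    degree. *)
Lemma deg_lt_span g x : deg_lt gr g x ->
  lin_span [set u | B u /\ exists2 h, gr h u & (h < g)%O] x.
Proof.
move=> gx; have [->|/(lead_exists basisB wo)[m xm]] := pselect (x = 0).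
  exact: lin_span0.
have [h hm] := monomial_degree xm.1; have [xh _] := lead_top_degree hm xm.
have hg : (h < g)%O by rewrite ltNge; apply/negP => /gx.
have [Bm [c c0 low]] := xm; rewrite -(subrK (c *: m) x); apply: lin_spanD.
  apply: lin_spanS low => u [Bu um]; split=> //.
  have [k ku] := monomial_degree Bu; exists k => //.
  by apply: le_lt_trans hg; apply: monomial_lt_degree um.
by apply/lin_spanZ/lin_span_mem; split=> //; exists h.
Qed.

(** Some [f] in [I] agrees with [x] in the degree of [m] and has no component above it; the rest of
    [f] has smaller degree and so involves only monomials below [m]. *)
Lemma LH_ideal_lead x m : ideal_set J x -> lead B lt x m ->
  exists2 f, ideal_set I f & lead B lt f m.
Proof.
move=> Jx xm; have [g gm] := monomial_degree xm.1.
have [f [If fg eq_fx]] := LH_ideal_hcomp grR g Jx; exists f => //.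
have -> : f = hcomp gr g x + (f - hcomp gr g x) by rewrite addrC subrK.
apply: leadD_low => //; first exact: lead_hcomp.
have /deg_lt_span : deg_lt gr g (f - hcomp gr g x).
  move=> h gh; rewrite (hcompB grR) (hcomp_gr grR h (gr_hcomp grR g x)).
  case: eqP => [->|/eqP hg]; first by rewrite eq_fx subrr.
  by rewrite subr0 fg // lt_neqAle eq_sym hg.
apply: lin_spanS => u [Bu [h hu hg]]; split=> //.
by apply: monomial_degree_lt hg => //; exact: xm.1.
Qed.

Lemma normal_LH_span0 x : lin_span N x -> ideal_set J x -> x = 0.
Proof. exact: (normal_span0 skewB admB LH_ideal_lead). Qed.

Lemma normal_ideal_span0 x : lin_span N x -> ideal_set I x -> x = 0.
Proof. by apply: (normal_span0 skewB admB) => f m If fm; exists f. Qed.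

(* [x] is the leading homogeneous part of some [f] in [I]; [y] is the normal
   form of the remaining terms [x - f], which have smaller degree. *)
Lemma LH_ideal_lift g x : gr g x -> ideal_set J x ->
  exists2 y, lin_span [set n | N n /\ exists2 h,
    gr h n & (h < g)%O] y & ideal_set I (x - y).
Proof.
move=> gx Jx; have [f [If fg]] := LH_ideal_hcomp grR g Jx.
rewrite (hcomp_gr grR _ gx) eqxx => def_x.
have : deg_lt gr g (x - f).
  move=> h gh; rewrite (hcompB grR) (hcomp_gr grR h gx).
  case: eqP => [->|/eqP hg]; first by rewrite def_x subrr.
  by rewrite fg ?subr0 // lt_neqAle eq_sym hg.
move=> /deg_lt_span Bxf.
suff [y Ny Iy] : exists2 y, lin_span [set n | N n /\ exists2 h,
  gr h n & (h < g)%O] y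
    & ideal_set I (x - f - y).
  by exists y => //; have := in_idealD idI Iy If; rewrite addrAC addrNK.
apply: (lin_span_mod idI) Bxf => u [Bu [h hu hg]].
have [y Ny Iy] := normal_reduction skewB admB I Bu; exists y => //.
apply: lin_spanS Ny => n [Nn nu]; split=> //; have [Bn _] := Nn.
case: nu => [->|nu]; first by exists h.
have [k kn] := monomial_degree Bn; exists k => //.
by apply: le_lt_trans hg; apply: monomial_lt_degree nu.
Qed.

End GradedMonomials.

(** * Division by a Groebner basis and normal forms modulo [<LH(I)>] *)

Section GroebnerBases.
Variables (K : fieldType) (d : Order.disp_t) (Gamma : osemigroupType d).
Variables (R : kalgType K) (gr : Gamma -> set R) (gens : seq R) (B : set R).
Variables (lt : R -> R -> Prop) (I : ideal R) (G : set R).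
Hypotheses (grR : gradation gr) (skewB : skew_multiplicative_basis gens B).
Hypothesis admB : admissible_system B lt TwoSided.
Hypothesis gr_lt : graded_monomial_ordering gr TwoSided B lt.
Hypothesis GbI : groebner_basis B lt I G.
Let J := LH_ideal gr I.
Let N := normal_monomials B lt I.
Let idI := idealP I.
Let idJ := idealP J.
Let basisB : is_basis B := admB.1.
Let indB : lin_indep B := basisB.1.
Let wo : well_ordering B lt. Proof. by case: admB => _ []. Qed.
Let le u v := u = v \/ lt u v.

Lemma groebner_divides f m : ideal_set I f -> lead B lt f m ->
  exists2 g, G g & exists mg a b l,
    [/\ lead B lt g mg, B a, B b, l != 0 & a * mg * b = l *: m].
Proof.
move=> If fm; have f0 := lead_neq0 basisB wo fm.
have [GI G0 /(_ f If f0)[g Gg]] := GbI.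
rewrite (LM_lead basisB wo fm) => -[l [a [b [l0 Ba Bb def_m]]]].
exists g => //; exists (LM B lt g), a, b, l^-1; split=> //;
  last by rewrite def_m scalerA mulVf // scale1r.
  by apply: lead_LM basisB wo _ (G0 g Gg).
by rewrite invr_eq0.
Qed.

(** Cancelling the leading term of [f] with a multiple of [a * h * b], [h] in [G], changes the
    component in the degree of [m] by a multiple of [a * LH gr h * b] and leaves 0 or a smaller
    leading monomial. *)
Lemma LH_ideal_groebner : (J : set R) = generated TwoSided (LH gr @` G).
Proof.
have [GI _ _] := GbI; apply/seteqP; split; last first.
  by apply: (generated_min idJ) => _ [g Gg <-]; apply: LH_ideal_mem; apply: GI.
have idP := generated_is_ideal (LH gr @` G).
have GP := @sub_generated _ _ (LH gr @` G).
move: (generated _ _) idP GP => P idP GP.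
suff main m : B m -> forall f g, ideal_set I f -> lead B lt f m -> gr g m ->
  P (hcomp gr g f).
  apply: (generated_min idP) => _ [f If <-].
  have [->|f0] := pselect (f = 0); first by rewrite (LH0 grR);
    apply: in_ideal0 idP.
  have [m fm] := lead_exists basisB wo f0.
  have [g [gm _ -> _]] := lead_LH grR admB gr_lt fm; exact: (main m fm.1).
move: m; apply: (well_ordering_ind wo) => m Bm IH f g If fm gm.
have [h Gh [mh [a [b [l [hm Ba Bb l0 def_m]]]]]] := groebner_divides If fm.
have [e [emh _ LHh _]] := lead_LH grR admB gr_lt hm.
have [[ga gr_a] [gb gr_b]] :=
  (monomial_degree gr_lt Ba, monomial_degree gr_lt Bb).
(* The nonzero element [l *: m] has degree [g] and, as a product, degree [ga * e * gb]. *)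
have def_g : g = (ga * e * gb)%g.
  apply: (gr_inj grR (x := l *: m)); first exact: grZ.
    by rewrite -def_m; apply: grM => //; apply: grM.
  by apply/eqP; rewrite scaler_eq0 (negPf l0); apply/eqP/(lin_indep_neq0 indB).
have hcomp_ahb : hcomp gr g (a * h * b) = a * LH gr h * b.
  by rewrite def_g hcompMr // hcompMl // LHh.
have [_ [c c0 low]] := fm.
have [_ [c' c'0 low']] := lead_mul skewB admB hm Ba Bb Bm l0 def_m.
(* The scalar [c / c'] is the quotient of the two coefficients of [m]. *)
pose f' := f - (c / c') *: (a * h * b).
have lowf' : lin_span [set u | B u /\ lt u m] f'.
  have -> : f' = (f - c *: m) - (c / c') *: (a * h * b - c' *: m).
    rewrite /f' scalerBr scalerA divfK // opprB.
    by rewrite addrA subrK.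
  by apply/lin_spanB/lin_spanZ.
have -> : f = f' + (c / c') *: (a * h * b) by rewrite /f' subrK.
rewrite (hcompD grR) (hcompZ grR) hcomp_ahb; apply: (in_idealD idP); last first.
  apply/(in_idealZ idP)/(in_idealMr idP)/(in_idealMl idP).
  by apply: GP; exists h.
have If' : ideal_set I f'.
  apply: (in_idealB idI) => //;
    apply/(in_idealZ idI)/(in_idealMr idI)/(in_idealMl idI).
  exact: GI.
have [->|[n [Bn nm] f'n]] := lead_lower wo Bm lowf'.
  by rewrite (hcomp0 grR); apply: in_ideal0 idP.
have [k kn] := monomial_degree gr_lt Bn.
have := monomial_lt_degree grR admB gr_lt Bn Bm kn gm nm.
(* Either the remainder still has degree [g], and induction applies, or its degree is smaller and
   its component of degree [g] is 0. *)
rewrite le_eqVlt => /predU1P[kg|kg]; first by apply: (IH n) => //; rewrite -kg.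
have [_ ->] := lead_top_degree grR admB gr_lt kn f'n;
  [exact: in_ideal0 idP|by []].
Qed.

(** The larger of the two monomials leads, and dividing by its coefficient makes it a multiple of
    the other modulo [J]. If the two coincide, [h] is a nonzero multiple of [m]. *)
Lemma skew_2nomial_lead h m : skew_2nomial B h -> lead B lt h m ->
  ideal_set J h ->
  ideal_set J m \/ exists n c, [/\ B n, lt n m & ideal_set J (m - c *: n)].
Proof.
move=> [u [v [l [Bu Bv l0 ->]]]] hm Jh.
have low k x y : B x -> lt x y -> lin_span [set z | B z /\ lt z y] (k *: x).
  by move=> Bx xy; apply/lin_spanZ/lin_span_mem.
have [_ _ lt_total _] := wo; have [uv|uv|vu] := lt_total u v Bu Bv.
- right; exists u, l; suff -> : m = v by [].
  apply: lead_unique basisB wo _ _ _ hm _; rewrite -scaleNr.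
  by apply: leadD_low (low _ _ _ Bu uv); apply: lead_self.
- left; rewrite uv -[X in X - _]scale1r -scalerBl in hm Jh.
  have l1 : 1 - l != 0.
    by apply/eqP => l1; apply: (lead_neq0 basisB wo hm); rewrite l1 scale0r.
  rewrite (lead_unique basisB wo hm (lead_scale lt Bv l1)).
  exact: (in_idealZE idJ l1).
- right; exists v, l^-1; have -> : m = u.
    apply: lead_unique basisB wo _ _ _ hm _;
      rewrite addrC -scaleNr -[v in _ + v]scale1r.
    by apply: leadD_low (low _ _ _ Bv vu); apply: lead_scale; rewrite ?oppr_eq0.
  split=> //; have -> : u - l^-1 *: v = (- l^-1) *: (v - l *: u).
    by rewrite scalerBr !scaleNr scalerA mulVf // scale1r opprK addrC.
  exact: (in_idealZ idJ).
Qed.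

Hypothesis LH_form : forall h, (LH gr @` G) h -> B h \/ skew_2nomial B h.

(** Each rewriting step replaces a monomial by at most one smaller monomial, so no sums arise. The
    bound [le n w] serves to find the normal form of 1. *)
Lemma LH_normal_form w : B w -> ideal_set J w \/
  exists n c, [/\ N n, le n w, c != 0 & ideal_set J (w - c *: n)].
Proof.
move: w; apply: (well_ordering_ind wo) => w Bw IH.
have [Nw|nNw] := pselect (N w).
  right; exists w, 1; rewrite oner_neq0 scale1r subrr; split=> //;
    first by left.
  exact: in_ideal0 idJ.
have [f If [f0 [l1 [a1 [b1 [l10 Ba1 Bb1 def_w1]]]]]] := not_normal Bw nNw.
have fm := lead_LM basisB wo f0; set m := LM B lt f in fm def_w1.
have [g Gg [mg [a2 [b2 [l2 [gm Ba2 Bb2 l20 def_m]]]]]] :=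
  groebner_divides If fm.
have w0 := lin_indep_neq0 indB Bw.
have [e [_ _ _ hm]] := lead_LH grR admB gr_lt gm.
have Jh : ideal_set J (LH gr g) by apply: LH_ideal_mem; case: GbI => + _ _;
  apply.
have Jabs x y z : ideal_set J x -> ideal_set J (y * x * z).
  by move=> Jx; apply: (in_idealMr idJ); apply: (in_idealMl idJ).
(* [m] divides [w] and [mg] divides [m]. The cofactors on each side merge into one monomial, since a
   zero product would make [w] zero. *)
have def_w : exists l a b, [/\ l != 0, B a, B b & w = l *: (a * mg * b)].
  have def_w : w = (l1 / l2) *: ((a1 * a2) * mg * (b2 * b1)).
    rewrite -scalerA {1}def_w1; congr (_ *: _);
      rewrite -[m]scale1r -(mulVf l20) -scalerA -def_m.
    by rewrite -kalg_scalerAr -kalg_scalerAl !mulrA.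
  have [a12|[la [a [la0 Ba def_a]]]] := monomial_mul skewB Ba1 Ba2.
    by case: w0; rewrite def_w a12 !mul0r scaler0.
  have [b12|[lb [b [lb0 Bb def_b]]]] := monomial_mul skewB Bb2 Bb1.
    by case: w0; rewrite def_w b12 mulr0 scaler0.
  exists (l1 / l2 * (la * lb)), a, b; split=> //.
    by rewrite !mulf_neq0 ?invr_eq0.
  rewrite {1}def_w def_a def_b -!kalg_scalerAl -kalg_scalerAr !scalerA mulrA //.
case: def_w => l [a [b [l0 Ba Bb def_w]]].
have [Jmg|[o [c [Bo omg Jmo]]]] : ideal_set J mg \/
    exists n c, [/\ B n, lt n mg & ideal_set J (mg - c *: n)].
  have [Bh|h2] := LH_form (h := LH gr g) (ex_intro2 _ _ g Gg erefl).
    by left; rewrite (lead_unique basisB wo hm (lead_self lt Bh)).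
  exact: skew_2nomial_lead h2 hm Jh.
  by left; rewrite def_w; apply: (in_idealZ idJ); apply: Jabs.
have Jw : ideal_set J (w - (l * c) *: (a * o * b)).
  suff -> : w - (l * c) *: (a * o * b) = l *: (a * (mg - c *: o) * b).
    by apply: (in_idealZ idJ); apply: Jabs.
  rewrite mulrBr mulrBl scalerBr -def_w; congr (_ - _).
  by rewrite -kalg_scalerAr -kalg_scalerAl scalerA.
(* [skew_2nomial_lead] allows [c = 0], and then [w] lies in [J]. *)
have [c0|c0] := eqVneq c 0.
  by left; move: Jw; rewrite c0 mulr0 scale0r subr0.
have [aob|[k [w' [k0 Bw' def_w']]]] := monomial_mul3 skewB Ba Bo Bb.
  by left; move: Jw; rewrite aob scaler0 subr0.
(* Up to scalars, [w'] and [w] come from [o] and [mg], with [o] below [mg], by the same factors [a]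
   and [b]. *)
have w'w : lt w' w.
  apply: (@monomial_mul_homo _ _ _ _ _ skewB admB o mg a b k l^-1) => //;
    rewrite ?invr_eq0 //.
    exact: gm.1.
  by rewrite def_w scalerA mulVf // scale1r.
rewrite def_w' scalerA in Jw.
have k'0 : l * c * k != 0 by rewrite !mulf_neq0.
have [Jw'|[n [c1 [Nn nw' c10 Jn]]]] := IH w' Bw' w'w.
  by left; rewrite -[w](subrK ((l * c * k) *: w'));
    apply: (in_idealD idJ) => //; apply: (in_idealZ idJ).
right; exists n, (l * c * k * c1); split=> //; last 1 first.
- have := in_idealD idJ Jw (in_idealZ idJ (l * c * k) Jn).
  by rewrite scalerBr scalerA addrA subrK.
- right; case: nw' => [->//|nw']; have [_ lt_trans _ _] := wo.
  by apply: lt_trans w'w => //; case: Nn.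
- by rewrite mulf_neq0.
Qed.

Let spanJ0 := normal_LH_span0 grR skewB admB gr_lt (I := I).
Let spanI0 := normal_ideal_span0 skewB admB (I := I).
Let indN : lin_indep N := normal_indep admB (I := I).

Lemma normal_basis_LH : is_basis (proj J @` N).
Proof.
apply: quot_basis => // x.
apply: (lin_span_mod idJ) (basis_span basisB x) => w Bw.
have [Jw|[n [c [Nn _ _ Jn]]]] := LH_normal_form Bw.
  by exists 0; [apply: lin_span0|rewrite subr0].
by exists (c *: n) => //; apply/lin_spanZ/lin_span_mem.
Qed.

Lemma normal_basis_ideal : is_basis (proj I @` N).
Proof.
apply: quot_basis => // x.
apply: (lin_span_mod idI) (basis_span basisB x) => w Bw.
have [y Ny Iy] := normal_reduction skewB admB I Bw; exists y => //.
by apply: lin_spanS Ny => n [].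
Qed.

Lemma skew_multiplicative_normal :
  skew_multiplicative_basis (map (proj J) gens) (proj J @` N).
Proof.
split; first exact: normal_basis_LH.
  move=> _ [n [Bn _] <-]; have [_ /(_ n Bn)[w [w_gens ->]] _] := skewB.
  exists [seq (proj J p.1, p.2) | p <- w]; split.
    by move=> _ /mapP[p wp ->]; apply/map_f/w_gens.
  by rewrite big_map rmorph_prod; apply: eq_bigr => p _; rewrite rmorphXn.
move=> _ _ [u [Bu _] <-] [v [Bv _] <-]; rewrite -rmorphM /=.
have [->|[l [w [l0 Bw ->]]]] := monomial_mul skewB Bu Bv; first by left;
  rewrite raddf0.
rewrite proj_is_scalable; have [Jw|[n [c [Nn _ c0 Jn]]]] := LH_normal_form Bw.
  by left; have /proj_eq0-> := Jw; rewrite scaler0.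
right; exists (l * c), (proj J n); split; first by rewrite mulf_neq0.
  by exists n.
by have /proj_eq-> := Jn; rewrite proj_is_scalable scalerA.
Qed.

(** The normal form of 1 is at most 1, and no monomial is below 1. If 1 is not a monomial, there are
    no monomials at all, so [R] is zero and 1 lies in [J]. *)
Lemma normal_one : ~ ideal_set J 1 -> N 1.
Proof.
move=> nJ1; have [B1|nB1] := pselect (B 1).
  have [//|[n [c [Nn n1 _ _]]]] := LH_normal_form B1.
  case: n1 => [<-//|n1]; have [Bn _] := Nn.
  by case: (monomial_not_lt1 skewB admB Bn n1).
case: nJ1; have := basis_span basisB 1; move: (1 : R).
apply: lin_span_sub => [|x y|k x|w Bw].
- exact: in_ideal0 idJ.
- exact: (in_idealD idJ).
- exact: (in_idealZ idJ).
- by case: nB1; apply: monomial_one skewB admB _ Bw.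
Qed.

Lemma normal_one_neq0 (q : quot J) : q <> 0 -> (proj J @` N) 1.
Proof.
move=> q0; exists 1; last exact: rmorph1; apply: normal_one => J1.
apply: q0; have [x <-] := proj_surj q; apply/proj_eq0.
by rewrite -[x]mulr1; apply: (in_idealMl idJ).
Qed.

(** * Transport of a graded ordering when [R/<LH(I)>] is a domain *)

Section Domain.
Hypothesis domJ : is_domain (quot J).
Variables (sd : side) (lthat : quot J -> quot J -> Prop).
Hypothesis gr_lthat : graded_monomial_ordering (quot_gr gr J) sd (proj J @` N)
  lthat.
Let ltI := transported_lt I N lthat.

Let wo_hat : well_ordering (proj J @` N) lthat. Proof. by case: gr_lthat =>
  _ []. Qed.
Let basisJ := normal_basis_LH.
Let basisI := normal_basis_ideal.
Let N1 : N 1.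
Proof. by apply: normal_one => J1; case: domJ => + _; apply;
  apply/proj_eq0. Qed.

Let injJ x y : N x -> N y -> proj J x = proj J y -> x = y.
Proof. exact: (proj_inj_on spanJ0). Qed.
Let injI x y : N x -> N y -> proj I x = proj I y -> x = y.
Proof. exact: (proj_inj_on spanI0). Qed.

Lemma transported_ltE u v : N u -> N v ->
  ltI (proj I u) (proj I v) <-> lthat (proj J u) (proj J v).
Proof.
move=> Nu Nv; split=> [[u' [v' [Nu' Nv' /injI-> // /injI-> //]]]|uv].
by exists u, v.
Qed.

Lemma transported_well_ordering : well_ordering (proj I @` N) ltI.
Proof.
have [lt_irr lt_trans lt_total lt_min] := wo_hat; split.
- by move=> _ [u Nu <-] /transported_ltE-/(_ Nu Nu); apply: lt_irr; exists u.
- move=> _ _ _ [u Nu <-] [v Nv <-] [w Nw <-] /transported_ltE-/(_ Nu Nv) uv.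
  move=> /transported_ltE-/(_ Nv Nw) vw; apply/transported_ltE => //.
  by apply: lt_trans uv vw; [exists u|exists v|exists w].
- move=> _ _ [u Nu <-] [v Nv <-].
  have [||uv|/injJ-> //|vu] := lt_total (proj J u) (proj J v);
    [by exists u|by exists v|..].
  + by apply: Or31; apply/transported_ltE.
  + exact: Or32.
  + by apply: Or33; apply/transported_ltE.
move=> S SN [_ /[dup] /SN[u Nu <-] Su].
have [||_ [m [Nm Sm] <-] m_min] :=
  lt_min (proj J @` [set n | N n /\ S (proj I n)]).
- by move=> _ [n [Nn _] <-]; exists n.
- by exists (proj J u), u.
exists (proj I m) => // q Sq.
have [n Nn def_q] := SN q Sq; rewrite -{q}def_q in Sq *.
have [/injJ->//|mn] := m_min (proj J n) (ex_intro2 _ _ n (conj Nn Sq) erefl);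
  first by left.
by right; apply/transported_ltE.
Qed.

(** Three factors cover all sides at once: the one-sided cases take [v = 1] or [s = 1], which is
    possible as 1 is normal. *)
Lemma transported_lead_mul v w s : N v -> N w -> N s -> exists n,
  [/\ N n, LM (proj J @` N) lthat (proj J v * proj J w * proj J s) = proj J n &
      LM (proj I @` N) ltI (proj I v * proj I w * proj I s) = proj I n].
Proof.
move=> Nv Nw Ns; have [[Bv _] [Bw _] [Bs _]] := And3 Nv Nw Ns.
have neq0 n : N n -> proj J n <> 0.
  move=> Nn /proj_eq0/(spanJ0 (lin_span_mem Nn)); apply: lin_indep_neq0 indB _.
  by case: Nn.
have domM (x y : quot J) : x <> 0 -> y <> 0 -> x * y <> 0.
  by case: domJ => _ dom x0 y0 /dom[].
have vws0 : proj J (v * w * s) <> 0.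
  by rewrite !rmorphM; apply: (domM); [apply: domM|]; apply: neq0.
rewrite -!rmorphM /=.
have [vws|[l [b [l0 Bb def_b]]]] := monomial_mul3 skewB Bv Bw Bs.
  by case: vws0; rewrite vws raddf0.
have nJb : ~ ideal_set J b.
  by move=> /proj_eq0 b0; apply: vws0;
    rewrite def_b proj_is_scalable b0 scaler0.
have [//|[n [c [Nn _ c0 Jbn]]]] := LH_normal_form Bb; have [Bn _] := Nn.
have [[g gb] [h hn]] := (monomial_degree gr_lt Bb, monomial_degree gr_lt Bn).
(* Otherwise the component of degree [g] of [b - c *: n] is [b], which would lie in the graded ideal
   [J]. *)
have hg : h = g.
  have [//|/eqP/negPf hg] := pselect (h = g); case: nJb.
  have := LH_ideal_graded grR g Jbn.
  rewrite (hcompB grR) (hcompZ grR) (hcomp_gr grR g gb) (hcomp_gr grR g hn)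
    eqxx.
  by rewrite eq_sym hg scaler0 subr0.
have gbn : gr g (b - c *: n).
  by rewrite addrC -scaleNr; apply: grD => //; apply: grZ => //; rewrite -hg.
(* Modulo [I], the homogeneous element [b - c *: n] of [J] becomes a combination of normal monomials
   of degree below [g]. *)
have [y Ny Iy] := LH_ideal_lift grR skewB admB gr_lt gbn Jbn.
have projJ_vws : proj J (v * w * s) = (l * c) *: proj J n.
  by rewrite def_b proj_is_scalable; have /proj_eq-> := Jbn;
    rewrite proj_is_scalable scalerA.
have projI_vws : proj I (v * w * s) = (l * c) *: proj I n + l *: proj I y.
  rewrite def_b proj_is_scalable;
    have : proj I (b - c *: n) = proj I y by apply/proj_eq.
  move/eqP; rewrite raddfB /= subr_eq => /eqP->; rewrite proj_is_scalable.
  by rewrite scalerDr scalerA addrC.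
have lc0 : l * c != 0 by rewrite mulf_neq0.
exists n; split=> //.
  rewrite projJ_vws; by apply: (LM_lead basisJ wo_hat); apply: lead_scale.
rewrite projI_vws; apply: (LM_lead basisI transported_well_ordering).
apply: leadD_low; first exact: lead_scale.
apply: lin_spanZ; move/(lin_span_proj I): Ny;
  apply: lin_spanS => _ [n' [Nn' [k kn' kg]] <-].
split; first by exists n'.
(* The monomials of [y] have smaller degree than [n], so the graded ordering puts their classes
   below that of [n]. *)
apply/transported_ltE => //; have [_ _ [lt' _ ltE]] := gr_lthat.
apply/ltE; [by exists n'|by exists n|]; exists k, g; split; last by left.
  by exists n'.
by exists n => //; rewrite -hg.
Qed.

(** [n] and [k *: 1] lie in the span of [N], on which [proj J] is injective, so equality modulo [J]
    is equality in [R]. *)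
Lemma in_scalars_proj n : N n -> in_scalars (proj J n) -> in_scalars (proj I n).
Proof.
move=> Nn [k nk]; exists k; rewrite -(rmorph1 (proj I)) -proj_is_scalable /=;
  congr proj.
apply: (proj_span_inj spanJ0);
  [exact: lin_span_mem|exact/lin_spanZ/lin_span_mem|].
by rewrite nk proj_is_scalable rmorph1.
Qed.

Lemma proj_neq1 n : N n -> proj I n <> 1 -> proj J n <> 1.
Proof.
move=> Nn n1 Jn1; apply: n1; rewrite -(rmorph1 (proj I)); congr proj.
by apply: injJ => //; rewrite Jn1 rmorph1.
Qed.

(** Products have corresponding leading monomials in [R/I] and [R/J], and the provisos on scalars
    and on 1 pass from [R/I] to [R/J]. *)
Lemma transported_monomial_ordering : monomial_ordering (proj I @` N) ltI sd.
Proof.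
have [_ [_ comp inc] _] := gr_lthat.
have memJ n : N n -> (proj J @` N) (proj J n) by exists n.
have compP x y m n : N x -> N y -> N m -> N n ->
    (lthat (proj J x) (proj J y) -> ~ in_scalars (proj J m) ->
       ~ in_scalars (proj J n) -> lthat (proj J m) (proj J n)) ->
    ltI (proj I x) (proj I y) -> ~ in_scalars (proj I m) ->
      ~ in_scalars (proj I n) ->
    ltI (proj I m) (proj I n).
  move=> Nx Ny Nm Nn H /transported_ltE-/(_ Nx Ny) xy nm nn.
  by apply/transported_ltE => //;
    apply: H => // [/(in_scalars_proj Nm)|/(in_scalars_proj Nn)].
split; first exact: transported_well_ordering.
- case: sd comp {inc} => /= comp.
  + move=> _ _ _ [w Nw <-] [u Nu <-] [v Nv <-].
    have [m [Nm Jm Im]] := transported_lead_mul Nv Nw N1.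
    have [n [Nn Jn In]] := transported_lead_mul Nv Nu N1.
    rewrite !rmorph1 !mulr1 in Jm Im Jn In; rewrite Im In; apply: compP => //.
    by rewrite -Jm -Jn; apply: comp; apply: memJ.
  + move=> _ _ _ [w Nw <-] [u Nu <-] [s Ns <-].
    have [m [Nm Jm Im]] := transported_lead_mul N1 Nw Ns.
    have [n [Nn Jn In]] := transported_lead_mul N1 Nu Ns.
    rewrite !rmorph1 !mul1r in Jm Im Jn In; rewrite Im In; apply: compP => //.
    by rewrite -Jm -Jn; apply: comp; apply: memJ.
  + move=> _ _ _ _ [w Nw <-] [u Nu <-] [v Nv <-] [s Ns <-].
    have [m [Nm Jm Im]] := transported_lead_mul Nv Nw Ns.
    have [n [Nn Jn In]] := transported_lead_mul Nv Nu Ns.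
    rewrite Im In; apply: compP => //.
    by rewrite -Jm -Jn; apply: comp; apply: memJ.
- case: sd inc {comp} => /= inc.
  + move=> _ _ _ [w Nw <-] [u Nu <-] [v Nv <-] v1.
    have [m [Nm Jm Im]] := transported_lead_mul Nv Nw N1.
    rewrite !rmorph1 !mulr1 in Jm Im; rewrite Im => /injI um; rewrite um //.
    apply/transported_ltE => //; rewrite -Jm.
    by apply: (inc _ _ (proj J v)) => //; rewrite ?Jm;
      [apply: memJ..|apply: proj_neq1].
  + move=> _ _ _ [w Nw <-] [u Nu <-] [s Ns <-] s1.
    have [m [Nm Jm Im]] := transported_lead_mul N1 Nw Ns.
    rewrite !rmorph1 !mul1r in Jm Im; rewrite Im => /injI um; rewrite um //.
    apply/transported_ltE => //; rewrite -Jm.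
    by apply: (inc _ _ (proj J s)) => //; rewrite ?Jm;
      [apply: memJ..|apply: proj_neq1].
  + move=> _ _ _ _ [w Nw <-] [u Nu <-] [v Nv <-] [s Ns <-] vs1.
    have [m [Nm Jm Im]] := transported_lead_mul Nv Nw Ns.
    rewrite Im => /injI um; rewrite um //.
    apply/transported_ltE => //; rewrite -Jm.
    apply: (inc _ _ (proj J v) (proj J s)) => //; rewrite ?Jm;
      [apply: memJ..|] => //.
    by case: vs1 => /proj_neq1; [left|right]; auto.
Qed.

Lemma groebner_theory_ideal : has_groebner_theory (proj I @` N) ltI sd.
Proof.
apply: groebner_theory_of_one normal_basis_ideal transported_well_ordering _ _
  _.
  exact: transported_monomial_ordering.
by move=> _ _; exists 1 => //; apply: rmorph1.
Qed.

End Domain.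
End GroebnerBases.

(** * The leading homogeneous algebra, its basis of normal monomials, and the lift to [R/I] *)

Theorem theorem4p5 (K : fieldType) (d : Order.disp_t)
    (Gamma : osemigroupType d) (R : kalgType K) (gr : Gamma -> set R)
    (gens : seq R) (B : set R) (ltgr : R -> R -> Prop)
    (I : ideal R) (G : set R) :
  generates_algebra gens ->
  gradation gr ->
  skew_multiplicative_basis gens B ->
  admissible_system B ltgr TwoSided ->
  graded_monomial_ordering gr TwoSided B ltgr ->
  (I : set R) = generated TwoSided G ->
  groebner_basis B ltgr I G ->
  (forall h, (LH gr @` G) h -> B h \/ skew_2nomial B h /\ homogeneous gr h) ->
  let J := LH_ideal gr I in
  let N := normal_monomials B ltgr I in
  [/\ [/\ (J : set R) = generated TwoSided (LH gr @` G),
          graded_ideal gr J,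
          skew_2nomial_ideal B J,
          skew_2nomial_algebra B (quot J) &
          almost_skew_2nomial gr B I],
      skew_multiplicative_basis (map (proj J) gens) (proj J @` N) /\
      (forall (sd : side) (lt : quot J -> quot J -> Prop),
         monomial_ordering (proj J @` N) lt sd ->
         has_skew_groebner_theory (proj J @` N) lt (map (proj J) gens) sd /\
         has_groebner_theory (proj J @` N) lt sd) &
      is_domain (quot J) ->
      forall (sd : side) (lthat : quot J -> quot J -> Prop),
        graded_monomial_ordering (quot_gr gr J) sd (proj J @` N) lthat ->
        has_groebner_theory (proj I @` N)
          (transported_lt I N lthat) sd].
Proof.
move=> _ grR skewB admB gr_lt _ GbI LH_2nomial J N.
have LH_form h : (LH gr @` G) h -> B h \/ skew_2nomial B h.
  by move=> /LH_2nomial[|[]]; [left|right].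
have J_gen : (J : set R) = generated TwoSided (LH gr @` G).
  exact: LH_ideal_groebner grR skewB admB gr_lt GbI.
have J2 : skew_2nomial_ideal B J.
  by exists (LH gr @` G).
have skewN : skew_multiplicative_basis (map (proj J) gens) (proj J @` N).
  exact: skew_multiplicative_normal grR skewB admB gr_lt GbI LH_form.
split.
- split=> //; first exact: graded_LH_ideal.
  (* The ideal presenting the 2-nomial algebra is [J] itself, with the identity as isomorphism. *)
  exists J; split=> //; exists idfun; split=> //; exact: inv_bij (fun=> erefl).
- split=> // sd lt mo; have [wo _ _] := mo; have [basisN _ _] := skewN.
  split; first by split.
  apply: groebner_theory_of_one basisN wo _ mo _ => q.
  exact: (normal_one_neq0 grR skewB admB gr_lt GbI LH_form).
- move=> domJ sd lthat gr_lthat.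
  exact (groebner_theory_ideal grR skewB admB gr_lt GbI LH_form domJ gr_lthat).
Qed.
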